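(* Let $n\ge2$ and let $q\in\mathbb{C}^\times$ be not a root of unity. Let $\mathbb{H}_n$ be the $GL_n$-type double affine Hecke algebra over $\mathbb{C}(\tau)$, graded by $\deg T_k=\deg Y_i^{\pm1}=0$, $\deg X_i^{\pm1}=\pm1$. Let $\mathfrak{A}\subset\mathbb{H}_n$ be the subalgebra generated by $X_1,\dots,X_n$, $D_1,\dots,D_n$, $Y_1^{\pm1},\dots,Y_n^{\pm1}$ and $T_1,\dots,T_{n-1}$, with the grading inherited from $\mathbb{H}_n$. Then the subalgebra $\mathbb{H}^{\mathfrak{gl}_n}$ generated by $T_k$ ($1\le k\le n-1$), $Y_i^{\pm1}$ ($1\le i\le n$) and $e_{ij}=X_iD_j$ ($1\le i\ne j\le n$) coincides with the degree zero part of $\mathfrak{A}$.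
   Context: $\mathbb{H}_n$ is the unital associative algebra over $\mathbb{C}(\tau)$ ($\tau$ a formal variable) generated by $T_k$ ($1\le k\le n-1$), $X_i^{\pm1}$, $Y_i^{\pm1}$ ($1\le i\le n$) with relations: $(T_k-\tau)(T_k+\tau^{-1})=0$; $T_lT_{l+1}T_l=T_{l+1}T_lT_{l+1}$ ($1\le l\le n-2$); $[T_k,T_l]=0$ if $|k-l|>1$; $T_kX_kT_k=X_{k+1}$, $[T_k,X_i]=0$ for $i\ne k,k+1$; $T_k^{-1}Y_kT_k^{-1}=Y_{k+1}$, $[T_k,Y_i]=0$ for $i\neq k,k+1$; $\widetilde Y X_i=qX_i\widetilde Y$ with $\widetilde Y=\prod_{i=1}^nY_i$; $Y_2^{-1}X_1Y_2X_1^{-1}=T_1^2$; the $X_i^{\pm1}$ are mutually inverse and commute with each other, and likewise the $Y_i^{\pm1}$. $D_n=(q-q^{-1})^{-1}X_n^{-1}(Y_n-Y_n^{-1})$ and, for $1\le i\le n-1$, $D_i=T_iT_{i+1}\cdots T_{n-1}\,D_n\,T_{n-1}\cdots T_{i+1}T_i$; thus $D_i$ has degree $-1$. *)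

(* Defs.v *)
(* MathComp, with the classical layer of MathComp-Analysis. *)
From HB Require Import structures.
From mathcomp Require Import all_boot all_order all_algebra.
From mathcomp Require Import generic_quotient.
From mathcomp Require Import boolp classical_sets reals.
From mathcomp Require Import complex.

Set Implicit Arguments.
Unset Strict Implicit.
Unset Printing Implicit Defensive.

Import GRing.Theory.
Local Open Scope ring_scope.
Local Open Scope classical_set_scope.
Local Open Scope quotient_scope.

(** * Unital associative algebras presented by generators and relations *)

(* Algebra expressions over K in the letters G.  A scalar c stands for c.1, so
   that scaling by c is multiplication by [Cst c]. *)
Inductive aterm (K G : Type) : Type :=
  | Gen of G
  | Cst of K
  | Add of aterm K G & aterm K G
  | Mul of aterm K G & aterm K G.
Arguments Gen {K G}.
Arguments Cst {K G}.

HB.instance Definition _ (K G : Type) := gen_eqMixin (aterm K G).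
HB.instance Definition _ (K G : Type) := gen_choiceMixin (aterm K G).

Declare Scope aterm_scope.
Delimit Scope aterm_scope with AT.
Bind Scope aterm_scope with aterm.
Notation "s + t" := (Add s t) : aterm_scope.
Notation "s * t" := (Mul s t) : aterm_scope.
Notation "s - t" := (Add s (Mul (Cst (-1)%R) t)) : aterm_scope.
Notation "c %:T" := (Cst c) : aterm_scope.

(* The least congruence that contains the relations rel and makes the
   expressions a unital associative K-algebra. *)
Inductive pres_eq (K : comNzRingType) (G : Type)
    (rel : aterm K G -> aterm K G -> Prop) : aterm K G -> aterm K G -> Prop :=
  | pe_rel s t : rel s t -> pres_eq rel s t
  | pe_refl s : pres_eq rel s s
  | pe_sym s t : pres_eq rel s t -> pres_eq rel t s
  | pe_trans s t u : pres_eq rel s t -> pres_eq rel t u -> pres_eq rel s u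
  | pe_add s s' t t' : pres_eq rel s s' -> pres_eq rel t t' ->
      pres_eq rel (s + t) (s' + t')
  | pe_mul s s' t t' : pres_eq rel s s' -> pres_eq rel t t' ->
      pres_eq rel (s * t) (s' * t')
  | pe_addA s t u : pres_eq rel (s + (t + u)) (s + t + u)
  | pe_addC s t : pres_eq rel (s + t) (t + s)
  | pe_add0 s : pres_eq rel (0%:T + s) s
  | pe_mulA s t u : pres_eq rel (s * (t * u)) (s * t * u)
  | pe_mul1l s : pres_eq rel (1%:T * s) s
  | pe_mulDl s t u : pres_eq rel ((s + t) * u) (s * u + t * u)
  | pe_mulDr s t u : pres_eq rel (s * (t + u)) (s * t + s * u)
  | pe_mul0l s : pres_eq rel (0%:T * s) 0%:T
  | pe_cstD a b : pres_eq rel (a + b)%R%:T (a%:T + b%:T)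
  | pe_cstM a b : pres_eq rel (a * b)%R%:T (a%:T * b%:T)
  | pe_cstC a s : pres_eq rel (a%:T * s) (s * a%:T).

Section Presented.
Context (K : comNzRingType) (G : Type) (rel : aterm K G -> aterm K G -> Prop).
Local Notation term := (aterm K G).
Local Notation "s ~~ t" := (pres_eq rel s t) (at level 70).

Definition pres_eqb (s t : term) : bool := `[< s ~~ t >].

Fact pres_eqb_refl : reflexive pres_eqb.
Proof. by move=> s; apply/asboolP; apply: pe_refl. Qed.
Fact pres_eqb_sym : symmetric pres_eqb.
Proof. by move=> s t; apply/asboolP/asboolP => /pe_sym. Qed.
Fact pres_eqb_trans : transitive pres_eqb.
Proof.
by move=> t s u /asboolP st /asboolP tu; apply/asboolP; apply: pe_trans st tu.
Qed.

Canonical pres_equiv :=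
  EquivRel pres_eqb pres_eqb_refl pres_eqb_sym pres_eqb_trans.

Definition presAlg : Type := {eq_quot pres_equiv}.

HB.instance Definition _ := Choice.on presAlg.
HB.instance Definition _ := EqQuotient.on presAlg.

Definition pres_pi (s : term) : presAlg := \pi_presAlg s.

Lemma pres_piP (s t : term) : pres_pi s = pres_pi t <-> s ~~ t.
Proof.
split=> [/eqquotP/asboolP //|st]; apply/eqquotP; exact/asboolP.
Qed.

Lemma pres_piW (P : presAlg -> Prop) :
  (forall s, P (pres_pi s)) -> forall x, P x.
Proof. by move=> Ps; elim/quotW. Qed.

Lemma repr_pi (s : term) : repr (pres_pi s) ~~ s.
Proof. by apply/pres_piP; rewrite /pres_pi reprK. Qed.

Definition pres_add (x y : presAlg) := pres_pi (repr x + repr y).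
Definition pres_mul (x y : presAlg) := pres_pi (repr x * repr y).
Definition pres_scale (a : K) (x : presAlg) := pres_pi (a%:T * repr x).
Definition pres_opp (x : presAlg) := pres_scale (-1) x.

Lemma pres_addE s t : pres_add (pres_pi s) (pres_pi t) = pres_pi (s + t).
Proof. by apply/pres_piP; apply: pe_add; apply: repr_pi. Qed.
Lemma pres_mulE s t : pres_mul (pres_pi s) (pres_pi t) = pres_pi (s * t).
Proof. by apply/pres_piP; apply: pe_mul; apply: repr_pi. Qed.
Lemma pres_scaleE a s : pres_scale a (pres_pi s) = pres_pi (a%:T * s).
Proof. by apply/pres_piP; apply: pe_mul; [apply: pe_refl|apply: repr_pi]. Qed.

Fact presA_addA : associative pres_add.
Proof.
elim/pres_piW=> s; elim/pres_piW=> t; elim/pres_piW=> u.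
by rewrite !pres_addE; apply/pres_piP; apply: pe_addA.
Qed.
Fact presA_addC : commutative pres_add.
Proof.
elim/pres_piW=> s; elim/pres_piW=> t.
by rewrite !pres_addE; apply/pres_piP; apply: pe_addC.
Qed.
Fact presA_add0 : left_id (pres_pi 0%:T) pres_add.
Proof. by elim/pres_piW=> s; rewrite pres_addE; apply/pres_piP/pe_add0. Qed.
Fact presA_addN : left_inverse (pres_pi 0%:T) pres_opp pres_add.
Proof.
elim/pres_piW=> s; rewrite /pres_opp pres_scaleE pres_addE; apply/pres_piP.
apply: pe_trans (pe_mul0l rel s).
apply: (@pe_trans _ _ _ _ ((-1)%:T * s + 1%:T * s)%AT).
  apply: pe_add; first exact: pe_refl.
  exact/pe_sym/pe_mul1l.
apply: pe_trans (pe_sym (pe_mulDl _ _ _ _)) _.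
apply: pe_mul; last exact: pe_refl.
by apply/pe_sym; rewrite -[X in Cst X](addNr 1); apply: pe_cstD.
Qed.

HB.instance Definition _ := GRing.isZmodule.Build presAlg presA_addA presA_addC presA_add0 presA_addN.

Fact presA_mulA : associative pres_mul.
Proof.
elim/pres_piW=> s; elim/pres_piW=> t; elim/pres_piW=> u.
by rewrite !pres_mulE; apply/pres_piP; apply: pe_mulA.
Qed.
Fact presA_mul1 : left_id (pres_pi 1%:T) pres_mul.
Proof. by elim/pres_piW=> s; rewrite pres_mulE; apply/pres_piP/pe_mul1l. Qed.
Fact presA_mulr1 : right_id (pres_pi 1%:T) pres_mul.
Proof.
elim/pres_piW=> s; rewrite pres_mulE; apply/pres_piP.
by apply: pe_trans (pe_sym (pe_cstC _ _ _)) (pe_mul1l _ _).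
Qed.
Fact presA_mulDl : left_distributive pres_mul +%R.
Proof.
elim/pres_piW=> s; elim/pres_piW=> t; elim/pres_piW=> u; rewrite /+%R/=.
by rewrite !(pres_mulE, pres_addE); apply/pres_piP; apply: pe_mulDl.
Qed.
Fact presA_mulDr : right_distributive pres_mul +%R.
Proof.
elim/pres_piW=> s; elim/pres_piW=> t; elim/pres_piW=> u; rewrite /+%R/=.
by rewrite !(pres_mulE, pres_addE); apply/pres_piP; apply: pe_mulDr.
Qed.

HB.instance Definition _ :=
  GRing.Zmodule_isPzRing.Build presAlg presA_mulA presA_mul1 presA_mulr1 presA_mulDl presA_mulDr.

Fact presA_scaleA a b (x : presAlg) :
  pres_scale a (pres_scale b x) = pres_scale (a * b) x.
Proof.
elim/pres_piW: x => s; rewrite !pres_scaleE; apply/pres_piP.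
apply: pe_trans (pe_mulA _ _ _ _) _; apply: pe_mul; last exact: pe_refl.
exact/pe_sym/pe_cstM.
Qed.
Fact presA_scale1 : left_id 1 pres_scale.
Proof. by elim/pres_piW=> s; rewrite pres_scaleE; apply/pres_piP/pe_mul1l. Qed.
Fact presA_scaleDr : right_distributive pres_scale +%R.
Proof.
move=> a; elim/pres_piW=> s; elim/pres_piW=> t; rewrite /+%R/=.
by rewrite !(pres_scaleE, pres_addE); apply/pres_piP; apply: pe_mulDr.
Qed.
Fact presA_scaleDl (x : presAlg) : {morph pres_scale^~ x : a b / a + b}.
Proof.
move=> a b; elim/pres_piW: x => s; rewrite [RHS]/+%R/=.
rewrite !(pres_scaleE, pres_addE); apply/pres_piP.
apply: pe_trans (pe_mul (pe_cstD _ _ _) (pe_refl _ _)) (pe_mulDl _ _ _ _).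
Qed.

HB.instance Definition _ :=
  GRing.Zmodule_isLmodule.Build K presAlg presA_scaleA presA_scale1 presA_scaleDr presA_scaleDl.

Lemma pres_piD s t : pres_pi (s + t) = pres_pi s + pres_pi t.
Proof. by rewrite -pres_addE. Qed.
Lemma pres_piM s t : pres_pi (s * t) = pres_pi s * pres_pi t.
Proof. by rewrite -pres_mulE. Qed.
Lemma pres_pi1 : pres_pi 1%:T = 1. Proof. by []. Qed.
Lemma pres_piC a : pres_pi a%:T = a *: (1 : presAlg).
Proof.
rewrite -pres_pi1 [RHS]pres_scaleE; apply/pres_piP.
by apply: pe_trans (pe_sym (pe_mul1l _ _)) (pe_sym (pe_cstC _ _ _)).
Qed.

Lemma pres_scalerAl a (x y : presAlg) : a *: (x * y) = (a *: x) * y.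
Proof.
elim/pres_piW: x => s; elim/pres_piW: y => t.
rewrite -pres_piM [LHS]pres_scaleE [a *: _]pres_scaleE -pres_piM.
exact/pres_piP/pe_mulA.
Qed.

Lemma pres_scalerAr a (x y : presAlg) : a *: (x * y) = x * (a *: y).
Proof.
elim/pres_piW: x => s; elim/pres_piW: y => t.
rewrite -pres_piM [LHS]pres_scaleE [a *: _]pres_scaleE -pres_piM.
apply/pres_piP; apply: pe_trans (pe_mulA _ _ _ _) _.
apply: pe_trans (pe_sym (pe_mulA _ _ _ _)).
by apply: pe_mul; [apply: pe_cstC|apply: pe_refl].
Qed.

Definition gen (g : G) : presAlg := pres_pi (Gen g).

Definition lin_span (S : set presAlg) : set presAlg :=
  smallest (fun V : set presAlg => GRing.submod_closed [in V]) S.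

(* The closure conditions of [GRing.subalg_closed], which is only available for
   rings known to satisfy 1 != 0. *)
Definition subalg (S : set presAlg) : set presAlg :=
  smallest (fun B : set presAlg => [/\ B 1, GRing.linear_closed [in B]
                                    & GRing.mulr_2closed [in B]]) S.

(* The degree d component for the grading determined by the degrees of the
   generators, meaningful when the relations are homogeneous. *)
Definition degree_part (deg : G -> int) (d : int) : set presAlg :=
  lin_span [set \prod_(g <- w) gen g | w in [set w | \sum_(g <- w) deg g = d]].

End Presented.

(** * The double affine Hecke algebra of type GL_n *)

(* Indices are shifted by one: T_1, ..., T_(n-1) are indexed by 'I_n.-1, and
   X_1, ..., X_n and Y_1, ..., Y_n by 'I_n.  XVgen and YVgen are the inverses. *)
Inductive daha_gen (n : nat) : Type :=
  | Tgen of 'I_n.-1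
  | Xgen of 'I_n
  | XVgen of 'I_n
  | Ygen of 'I_n
  | YVgen of 'I_n.

Section DahaRelations.
Context (K : fieldType) (n : nat) (q tau : K).
Local Notation T k := (Gen (Tgen k)).
Local Notation X i := (Gen (Xgen i)).
Local Notation XV i := (Gen (XVgen i)).
Local Notation Y i := (Gen (Ygen i)).
Local Notation YV i := (Gen (YVgen i)).

(* T_k^-1, as given by the quadratic relation. *)
Local Notation TV k := (T k - (tau - tau^-1)%R%:T)%AT.

(* Y_1 Y_2 ... Y_n *)
Local Notation Yprod := (foldr (fun i s => (Y i * s)%AT) 1%:T%AT (enum 'I_n)).

Inductive daha_rel : aterm K (daha_gen n) -> aterm K (daha_gen n) -> Prop :=
  | rel_quadratic (k : 'I_n.-1) :
      daha_rel ((T k - tau%:T) * (T k + tau^-1%R%:T)) 0%:T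
  | rel_braid (k l : 'I_n.-1) : l = k.+1 :> nat ->
      daha_rel (T k * T l * T k) (T l * T k * T l)
  | rel_TT (k l : 'I_n.-1) : (k.+1 < l)%N || (l.+1 < k)%N ->
      daha_rel (T k * T l) (T l * T k)
  | rel_TXT (k : 'I_n.-1) (i j : 'I_n) : i = k :> nat -> j = k.+1 :> nat ->
      daha_rel (T k * X i * T k) (X j)
  | rel_TX (k : 'I_n.-1) (i : 'I_n) : i != k :> nat -> i != k.+1 :> nat ->
      daha_rel (T k * X i) (X i * T k)
  | rel_TYT (k : 'I_n.-1) (i j : 'I_n) : i = k :> nat -> j = k.+1 :> nat ->
      daha_rel (TV k * Y i * TV k) (Y j)
  | rel_TY (k : 'I_n.-1) (i : 'I_n) : i != k :> nat -> i != k.+1 :> nat ->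
      daha_rel (T k * Y i) (Y i * T k)
  | rel_YprodX (i : 'I_n) : daha_rel (Yprod * X i) (q%:T * (X i * Yprod))
  | rel_YXYX (k : 'I_n.-1) (i j : 'I_n) :
      k = 0%N :> nat -> i = 0%N :> nat -> j = 1%N :> nat ->
      daha_rel (YV j * X i * Y j * XV i) (T k * T k)
  | rel_XXV (i : 'I_n) : daha_rel (X i * XV i) 1%:T
  | rel_XVX (i : 'I_n) : daha_rel (XV i * X i) 1%:T
  | rel_XX (i j : 'I_n) : daha_rel (X i * X j) (X j * X i)
  | rel_YYV (i : 'I_n) : daha_rel (Y i * YV i) 1%:T
  | rel_YVY (i : 'I_n) : daha_rel (YV i * Y i) 1%:T
  | rel_YY (i j : 'I_n) : daha_rel (Y i * Y j) (Y j * Y i).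

End DahaRelations.

Notation daha n q tau := (presAlg (@daha_rel _ n q tau)).

Definition daha_deg (n : nat) (g : daha_gen n) : int :=
  match g with Xgen _ => 1 | XVgen _ => -1 | _ => 0 end.

Fact last_ord_proof n (i : 'I_n) : (n.-1 < n)%N.
Proof. by rewrite ltn_predL (leq_ltn_trans (leq0n i)). Qed.

Definition last_ord n (i : 'I_n) : 'I_n := Ordinal (last_ord_proof i).

Section Daha.
Context (K : fieldType) (n : nat) (q tau : K).
Local Notation H := (daha n q tau).

Definition dT (k : 'I_n.-1) : H := gen _ (Tgen k).
Definition dX (i : 'I_n) : H := gen _ (Xgen i).
Definition dXV (i : 'I_n) : H := gen _ (XVgen i).
Definition dY (i : 'I_n) : H := gen _ (Ygen i).
Definition dYV (i : 'I_n) : H := gen _ (YVgen i).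

(* D_i = T_i ... T_(n-1) D_n T_(n-1) ... T_i; both products are empty for the
   last index. *)
Definition dD (i : 'I_n) : H :=
  let l := last_ord i in
  (\prod_(k <- enum 'I_n.-1 | (i <= k)%N) dT k)
  * ((q - q^-1)^-1 *: (dXV l * (dY l - dYV l)))
  * (\prod_(k <- rev (enum 'I_n.-1) | (i <= k)%N) dT k).

Definition de (i j : 'I_n) : H := dX i * dD j.

Definition daha_part (d : int) : set H := degree_part (@daha_deg n) d.

Definition frakA : set H :=
  subalg (range dX `|` range dD `|` range dY `|` range dYV `|` range dT).

Definition Hgl : set H :=
  subalg (range dT `|` range dY `|` range dYV
          `|` [set de ij.1 ij.2 | ij in [set ij | ij.1 != ij.2]]).

End Daha.

Arguments daha_part {K} n q tau d _ : rename.
Arguments frakA {K} n q tau _ : rename.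
Arguments Hgl {K} n q tau _ : rename.

(** * The base field C(tau) *)

Definition Ctau (R : realType) : fieldType := {fraction {poly (complex R)}}.
Definition tauC (R : realType) : Ctau R := tofrac 'X.
Definition embC (R : realType) (c : complex R) : Ctau R := tofrac c%:P.

(* Main.v *)
Require Import Defs.
From mathcomp Require Import all_boot all_order all_algebra.
From mathcomp Require Import boolp classical_sets reals.
From mathcomp Require Import complex.
From mathcomp Require Import zify.

Set Implicit Arguments.
Unset Strict Implicit.
Unset Printing Implicit Defensive.

Import GRing.Theory.
Local Open Scope ring_scope.
Local Open Scope classical_set_scope.

(** Let rho = T_(n-1) ... T_1 X_1 = X_n T_(n-1)^-1 ... T_1^-1.  It is invertible and
    satisfies T_i rho = rho T_(i+1), Y_i rho = rho Y_(i+1), Y_n rho = q rho Y_1 and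
    T_(n-1) rho^2 = rho^2 T_1.  With F the affine Hecke algebra generated by the T_i
    and Y_i^(+-1), and v = T_1 ... T_(n-1) D_n = rho^-1 (Y_n - Y_n^-1) / (q - q^-1),
    the algebra A is generated by F, rho and v.

    Both rho v and v rho lie in F, rho T_1 v is e_21 up to units of F, and
    v T_(n-1) rho - rho T_1 v lies in F.  Decomposing F into double cosets of its
    parabolic subalgebras omitting T_1, respectively T_(n-1), one finds that
    rho f v and v f rho lie in F + F (rho T_1 v) F for all f in F; this allows
    rho and v to be exchanged at the cost of elements of F.  Hence, with B = H^gl_n,
    the sum of the (F rho)^k B and the (F v)^k B is stable under left multiplication
    by A, and contains A.  These layers are eigenspaces of the automorphism
    X_i -> q X_i for the distinct eigenvalues q^k and q^-k, so that an element of A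
    of degree zero lies in the layer k = 0, which is B. *)

(** * Linear spans and generated subalgebras of a presented algebra *)

Section SubspacesAndSubalgebras.
Context (K : comNzRingType) (G : Type) (rel : aterm K G -> aterm K G -> Prop).
Local Notation A := (presAlg rel).
Implicit Types (V S B : set A) (x y z : A) (a : K).

Definition subspace V := V 0 /\ forall a x y, V x -> V y -> V (a *: x + y).

Definition is_subalg B := [/\ B 1, subspace B & forall x y, B x -> B y -> B (x * y)].

Lemma subspaceP V : GRing.submod_closed [in V] <-> subspace V.
Proof.
split=> -[V0 VD]; split.
- by move: V0; rewrite inE.
- by move=> a x y Vx Vy; have := VD a x y; rewrite !inE; apply.
- by rewrite inE.
- by move=> a x y; rewrite !inE; apply: VD.
Qed.

Lemma is_subalgP B :
  [/\ B 1, GRing.linear_closed [in B] & GRing.mulr_2closed [in B]] <-> is_subalg B.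
Proof.
split.
  case=> B1 BD BM.
  have BD' a x y : B x -> B y -> B (a *: x + y).
    by move=> Bx By; have := BD a x y; rewrite !inE; apply.
  split=> //; first split=> //.
    by rewrite -[X in B X](addNr (1 : A)) -scaleN1r; apply: BD'.
  by move=> x y Bx By; have := BM x y; rewrite !inE; apply.
case=> B1 [_ BD] BM; split=> //.
- by move=> a x y; rewrite !inE; apply: BD.
- by move=> x y; rewrite !inE; apply: BM.
Qed.

Lemma subspaceD V x y : subspace V -> V x -> V y -> V (x + y).
Proof. by case=> _ VD Vx Vy; rewrite -[x]scale1r; apply: VD. Qed.

Lemma subspaceZ V a x : subspace V -> V x -> V (a *: x).
Proof. by case=> V0 VD Vx; rewrite -[_ *: _]addr0; apply: VD. Qed.

Lemma subspaceB V x y : subspace V -> V x -> V y -> V (x - y).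
Proof. by move=> sV Vx Vy; rewrite -scaleN1r addrC; apply: sV.2. Qed.

Lemma mul_comblr a x y u v : u * (a *: x + y) * v = a *: (u * x * v) + u * y * v.
Proof. by rewrite mulrDr mulrDl -pres_scalerAr -pres_scalerAl. Qed.

Lemma mul_combl a x y u : u * (a *: x + y) = a *: (u * x) + u * y.
Proof. by rewrite mulrDr -pres_scalerAr. Qed.

Lemma mul_combr a x y u : (a *: x + y) * u = a *: (x * u) + y * u.
Proof. by rewrite mulrDl -pres_scalerAl. Qed.

Lemma lin_span_subspace S : subspace (lin_span S).
Proof.
split; first by move=> V [[V0 _] _]; move: V0; rewrite inE.
move=> a x y Sx Sy V VP; have sV := (subspaceP V).1 VP.1.
by apply: sV.2; [apply: Sx | apply: Sy].
Qed.

Lemma lin_span_gen S x : S x -> lin_span S x.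
Proof. by move=> Sx V [_]; apply. Qed.

Lemma lin_span_ind S V : subspace V -> S `<=` V -> lin_span S `<=` V.
Proof. by move=> sV SV x; apply; split=> //; apply/subspaceP. Qed.

(** Linearity of [u * x * v] in [x]. One-sided products are the cases [u = 1] or [v = 1], which is
    why a factor [1] is inserted before most uses. *)
Lemma lin_span_mul S V u v : subspace V -> (forall x, S x -> V (u * x * v)) ->
  forall x, lin_span S x -> V (u * x * v).
Proof.
move=> sV SV; apply: (@lin_span_ind S (fun x => V (u * x * v))) => //.
split=> [|a x y Vx Vy]; first by rewrite mulr0 mul0r; case: sV.
by rewrite mul_comblr; apply: sV.2.
Qed.

Lemma subalg_is_subalg S : is_subalg (subalg S).
Proof.
split; first by move=> B [/is_subalgP[]].
  split; first by move=> B [/is_subalgP[_ []]].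
  move=> a x y Sx Sy B BP; have [_ [_ BD] _] := (is_subalgP B).1 BP.1.
  by apply: BD; [apply: Sx | apply: Sy].
move=> x y Sx Sy B BP; have [_ _ BM] := (is_subalgP B).1 BP.1.
by apply: BM; [apply: Sx | apply: Sy].
Qed.

Lemma subalg1 S : subalg S 1. Proof. by case: (subalg_is_subalg S). Qed.
Lemma subalg_subspace S : subspace (subalg S).
Proof. by case: (subalg_is_subalg S). Qed.
Lemma subalgM S x y : subalg S x -> subalg S y -> subalg S (x * y).
Proof. by case: (subalg_is_subalg S) => _ _; apply. Qed.

Lemma subalg_gen S x : S x -> subalg S x.
Proof. by move=> Sx B [_]; apply. Qed.

Lemma subalg_ind S B : is_subalg B -> S `<=` B -> subalg S `<=` B.
Proof. by move=> sB SB x; apply; split=> //; apply/is_subalgP. Qed.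

Lemma subalg_sub S S' : S `<=` subalg S' -> subalg S `<=` subalg S'.
Proof. by apply: subalg_ind; apply: subalg_is_subalg. Qed.

Lemma subalg_prod S I (r : seq I) (P : pred I) (F : I -> A) :
  (forall i, P i -> S (F i)) -> subalg S (\prod_(i <- r | P i) F i).
Proof.
move=> SF; apply: (big_ind (subalg S)) => [|x y|i Pi]; first exact: subalg1.
  exact: subalgM.
by apply: subalg_gen; apply: SF.
Qed.

(** The [y] with [V * y] contained in [V] form a subalgebra. It contains [S], hence all of
    [subalg S], and it acts on [1]. *)
Lemma subalg_mulr_ind S V : subspace V -> V 1 ->
  (forall x s, V x -> S s -> V (x * s)) -> subalg S `<=` V.
Proof.
move=> sV V1 VS x Sx; rewrite -[x]mul1r; move: x Sx 1 V1.
apply: (@subalg_ind S (fun y => forall x, V x -> V (x * y))).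
  split=> [x||y z Vy Vz x Vx]; rewrite ?mulr1 ?mulrA //.
    split=> [x _|a y z Vy Vz x Vx]; first by rewrite mulr0; case: sV.
    by rewrite mul_combl; apply: sV.2; [apply: Vy | apply: Vz].
  by apply: Vz; apply: Vy.
by move=> s Ss x Vx; apply: VS.
Qed.

Lemma subalg_mull_ind S V : subspace V -> V 1 ->
  (forall x s, V x -> S s -> V (s * x)) -> subalg S `<=` V.
Proof.
move=> sV V1 VS x Sx; rewrite -[x]mulr1; move: x Sx 1 V1.
apply: (@subalg_ind S (fun y => forall x, V x -> V (y * x))).
  split=> [x||y z Vy Vz x Vx]; rewrite ?mul1r -?mulrA //.
    split=> [x _|a y z Vy Vz x Vx]; first by rewrite mul0r; case: sV.
    by rewrite mul_combr; apply: sV.2; [apply: Vy | apply: Vz].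
  by apply: Vy; apply: Vz.
by move=> s Ss x Vx; apply: VS.
Qed.

(** If [x * b = g * x] and [x * b' = g' * x], then [x * (b * b') = g * g' * x]. Moving [x] past a
    generated subalgebra can thus be checked on generators. *)
Lemma semicommute_subalg B x : is_subalg B ->
  is_subalg [set b | exists2 g, B g & x * b = g * x].
Proof.
case=> B1 sB BM; split; first by exists 1; rewrite // mulr1 mul1r.
  split; first by exists 0; [case: sB | rewrite mulr0 mul0r].
  move=> a b b' [g Bg e] [g' Bg' e']; exists (a *: g + g'); first exact: sB.2.
  by rewrite mul_combl mul_combr e e'.
move=> b b' [g Bg e] [g' Bg' e']; exists (g * g'); first exact: BM.
by rewrite mulrA e -mulrA e' mulrA.
Qed.

Lemma semicommuter_subalg B x : is_subalg B ->
  is_subalg [set b | exists2 g, B g & b * x = x * g].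
Proof.
case=> B1 sB BM; split; first by exists 1; rewrite // mulr1 mul1r.
  split; first by exists 0; [case: sB | rewrite mulr0 mul0r].
  move=> a b b' [g Bg e] [g' Bg' e']; exists (a *: g + g'); first exact: sB.2.
  by rewrite mul_combl mul_combr e e'.
move=> b b' [g Bg e] [g' Bg' e']; exists (g * g'); first exact: BM.
by rewrite -mulrA e' mulrA e mulrA.
Qed.

End SubspacesAndSubalgebras.

(** * Double cosets of a parabolic subalgebra in a Hecke algebra of type A *)

Section HeckeCosets.
Context (K : comNzRingType) (G : Type) (rel : aterm K G -> aterm K G -> Prop).
Local Notation A := (presAlg rel).
Variables (N : nat) (t : nat -> A) (b : K).
Hypothesis quadratic : forall i, (i < N)%N -> t i * t i = b *: t i + 1.
Hypothesis braid :
  forall i, (i.+1 < N)%N -> t i * t i.+1 * t i = t i.+1 * t i * t i.+1.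
Hypothesis commute_far :
  forall i j, (i.+1 < j)%N -> (j < N)%N -> t i * t j = t j * t i.

(** For [j <= N] these lift the shortest representatives of the cosets of S_1 x S_N in S_(N+1). *)
Let cos j := \prod_(0 <= i < j) t i.

Let cosS j : cos j.+1 = cos j * t j.
Proof. by rewrite /cos big_nat_recr. Qed.

Let cos_far i j : (j < i)%N -> (i < N)%N -> cos j * t i = t i * cos j.
Proof.
elim: j => [|j IH] ji iN; first by rewrite /cos big_nil mul1r mulr1.
by rewrite cosS -mulrA commute_far // mulrA (IH (ltnW ji) iN) mulrA.
Qed.

(** Moving left, [t i] passes the factors beyond [t i.+1], turns into [t i.+1] by the braid
    relation, and passes the factors before [t i]. *)
Let cos_shift i j : (i.+1 < j)%N -> (j <= N)%N -> cos j * t i = t i.+1 * cos j.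
Proof.
elim: j => [//|j IH]; rewrite ltnS leq_eqVlt => /orP[/eqP <-|ij] jN.
  by rewrite !cosS -!mulrA (mulrA (t i)) braid // -!mulrA mulrA cos_far // -mulrA.
by rewrite cosS -mulrA -commute_far // mulrA (IH ij (ltnW jN)) mulrA.
Qed.

Definition parabolic := subalg [set t i | i in [set i | 0 < i < N]%N].

(** The span [V] of the [h * cos j] with [h] parabolic is stable under right multiplication by the
    [t i], so it contains the whole algebra. For [j > 0] every factor of [cos j] except the first is
    parabolic, so only the double cosets of [1] and [t 0] remain. *)
Lemma hecke_double_coset : subalg [set t i | i in [set i | i < N]%N] `<=`
  lin_span [set x | parabolic x \/
    exists2 h, parabolic h & exists2 h', parabolic h' & x = h * t 0%N * h'].
Proof.
pose V := lin_span [set x | exists2 h, parabolic h & exists2 j, (j <= N)%N & x = h * cos j].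
have sV : subspace V by apply: lin_span_subspace.
have Vg h j : parabolic h -> (j <= N)%N -> V (h * cos j).
  by move=> Hh jN; apply: lin_span_gen; exists h => //; exists j.
have par_t i : (0 < i < N)%N -> parabolic (t i).
  by move=> iN; apply: subalg_gen; exists i.
move=> x Hx; suff: V x.
  move: x {Hx}; apply: lin_span_ind => [|x]; first exact: lin_span_subspace.
  case=> h Hh [[|j] jN ->]; apply: lin_span_gen.
    by left; rewrite /cos big_nil mulr1.
  right; exists h => //; exists (\prod_(1 <= i < j.+1) t i).
    rewrite big_seq; apply: subalg_prod => i.
    by rewrite mem_index_iota => /andP[i0 ij]; exists i => //=; rewrite i0 (leq_trans ij).
  by rewrite /cos big_ltn // mulrA.
move: x Hx; apply: subalg_mulr_ind => //.
  have := Vg 1 0%N; rewrite /cos big_nil mulr1; apply=> //; apply: subalg1.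
move=> x _ Vx [i /= iN <-]; rewrite -[x]mul1r; move: x Vx.
apply: lin_span_mul => // x [h Hh [j jN ->]]; rewrite mul1r -mulrA.
(* For [i < j], either [i = j - 1] and the quadratic relation applies, or [t i] comes out on the
   left as [t i.+1]. For [i > j] it comes out unchanged. The index that comes out is positive, so
   the factor is parabolic. *)
case: (ltngtP i j) => [ij|ji|<-].
- case: j jN ij => // j jN; rewrite ltnS leq_eqVlt => /orP[/eqP eij|ij].
    rewrite cosS -mulrA -eij quadratic // mul_combl -cosS mulr1 mul_combl.
    by apply: sV.2; apply: Vg => //; rewrite ltnW.
  rewrite cos_shift // mulrA; apply: Vg => //.
  by apply: subalgM => //; apply: par_t; rewrite /= (leq_ltn_trans ij).
- rewrite cos_far // mulrA; apply: Vg => //.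
  by apply: subalgM => //; apply: par_t; rewrite iN (leq_ltn_trans _ ji).
- by rewrite -cosS; apply: Vg.
Qed.

End HeckeCosets.

(** * The layers (F w)^k B and the exchange of two elements *)

Section Ladder.
Context (K : comNzRingType) (G : Type) (rel : aterm K G -> aterm K G -> Prop).
Local Notation A := (presAlg rel).
Variables (F B : set A).
Hypotheses (sF : is_subalg F) (sB : is_subalg B) (FB : F `<=` B).

(** The layer (F w)^k B; the leftmost [w] is split off because the layers are multiplied from the
    left. *)
Fixpoint ladder (w : A) (k : nat) : set A :=
  if k is k.+1
  then lin_span [set x | exists2 f, F f & exists2 y, ladder w k y & x = f * w * y]
  else B.

Lemma ladder_subspace w k : subspace (ladder w k).
Proof. by case: k => [|k]; [case: sB | apply: lin_span_subspace]. Qed.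

Lemma ladder_mull w k f x : F f -> ladder w k x -> ladder w k (f * x).
Proof.
have [_ _ FM] := sF; have [_ _ BM] := sB.
case: k => [|k] Ff => [|Lx]; first exact/BM/FB.
rewrite -[_ * x]mulr1; move: x Lx; apply: lin_span_mul.
  exact: lin_span_subspace.
move=> x [g Fg [y Ly ->]]; apply: lin_span_gen.
by exists (f * g); [apply: FM | exists y; rewrite // mulr1 !mulrA].
Qed.

Lemma ladder_up w k x : ladder w k x -> ladder w k.+1 (w * x).
Proof.
move=> Lx; apply: lin_span_gen; exists 1; first by case: sF.
by exists x; rewrite // mul1r.
Qed.

(** This is F + F v F u F, where [u] either has disappeared together with [v] or stands to the right
    of it. *)
Definition exchange (u v : A) := lin_span [set x | F x \/
  exists2 f, F f & exists2 g, F g & exists2 h, F h & x = f * v * g * u * h].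

(** Induction on [k]. In [u * f * v * y], a term of [u * f * v] in [F] leaves [y], which is already
    one level lower. In a term [f1 * v * f2 * u * f3], the induction hypothesis lets [u] lower
    [f3 * y], and [v] raises the result again. At [k = 0] the product [u * f * v] lies in [B]. *)
Lemma ladder_down u v k x :
  (forall f, F f -> B (u * f * v)) -> (forall f, F f -> exchange u v (u * f * v)) ->
  ladder v k.+1 x -> ladder v k (u * x).
Proof.
move=> uvB uvE; elim: k x => [|k IH] x Lx; rewrite -[_ * x]mulr1; move: x Lx.
  apply: lin_span_mul => [|x [f Ff [y By ->]]]; first exact: (ladder_subspace v 0).
  by rewrite mulr1 !mulrA; case: sB => _ _; apply=> //; apply: uvB.
apply: lin_span_mul => [|x [f Ff [y Ly ->]]]; first exact: ladder_subspace.
rewrite mulr1 !mulrA -[X in ladder _ _ (X * y)]mul1r.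
move: (u * f * v) (uvE f Ff); apply: lin_span_mul.
  exact: ladder_subspace.
move=> z [Fz|[f1 F1 [f2 F2 [f3 F3 ->]]]]; rewrite mul1r.
  exact: ladder_mull.
rewrite -!mulrA; apply: ladder_mull => //; apply: ladder_up.
by apply: ladder_mull => //; apply: IH; apply: ladder_mull.
Qed.

(** For [f = p * t * p'] the outer factors are moved outside, giving
    [g * (u * t * v) * h = g * (s + r) * h]. For [f] in [P] one gets [g * (u * v)], which lies in
    [F]. *)
Lemma sandwich (P : set A) u v t s r :
  P `<=` F -> is_subalg P ->
  (forall p, P p -> exists2 g, F g & u * p = g * u) ->
  (forall p, P p -> exists2 g, F g & p * v = v * g) ->
  F `<=` lin_span [set x | P x \/ exists2 p, P p & exists2 p', P p' & x = p * t * p'] ->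
  F (u * v) -> u * t * v = s + r -> F r ->
  forall f, F f ->
  lin_span [set x | F x \/ exists2 g, F g & exists2 h, F h & x = g * s * h] (u * f * v).
Proof.
have [F1 sF' FM] := sF.
move=> PF sP uP Pv Fdec Fuv uts Fr f /Fdec; move: f; apply: lin_span_mul.
  exact: lin_span_subspace.
move=> x [Px|[p Pp [p' Pp' ->]]].
  have [g Fg ->] := uP x Px; apply: lin_span_gen; left.
  by rewrite -mulrA; apply: FM.
have [g Fg e] := uP p Pp; have [h Fh e'] := Pv p' Pp'.
rewrite !mulrA e -(mulrA _ p') e' mulrA -!(mulrA g) uts mulrDl mulrDr !mulrA.
apply: (subspaceD (@lin_span_subspace _ _ _ _)).
  by apply: lin_span_gen; right; exists g => //; exists h.
by apply: lin_span_gen; left; apply: (FM) => //; apply: FM.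
Qed.

End Ladder.

(** * Endomorphisms determined by the images of the generators *)

Section Twist.
Context (K : comNzRingType) (G : Type) (rel : aterm K G -> aterm K G -> Prop).
Local Notation A := (presAlg rel).
Variable h : G -> A.

Fixpoint aeval (s : aterm K G) : A :=
  match s with
  | Gen g => h g
  | Cst a => a *: (1 : A)
  | Add s t => aeval s + aeval t
  | Mul s t => aeval s * aeval t
  end.

Hypothesis h_rel : forall s t, rel s t -> aeval s = aeval t.

Lemma aeval_pres_eq s t : pres_eq rel s t -> aeval s = aeval t.
Proof.
elim=> /= [s1 t1|s1|s1 t1 _ ->|s1 t1 u1 _ -> _ ->|s1 s2 t1 t2 _ -> _ ->
  |s1 s2 t1 t2 _ -> _ ->|s1 t1 u1|s1 t1|s1|s1 t1 u1|s1|s1 t1 u1|s1 t1 u1|s1|a a'|a a'|a s1] //.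
- exact: h_rel.
- by rewrite addrA.
- by rewrite addrC.
- by rewrite scale0r add0r.
- by rewrite mulrA.
- by rewrite scale1r mul1r.
- by rewrite mulrDl.
- by rewrite mulrDr.
- by rewrite scale0r mul0r.
- by rewrite scalerDl.
- by rewrite -pres_scalerAl mul1r scalerA.
- by rewrite -pres_scalerAl -pres_scalerAr mul1r mulr1.
Qed.

(** Evaluation of a chosen representative; the choice is immaterial by [aeval_pres_eq]. *)
Definition pres_ext (x : A) : A := aeval (repr x).

Lemma pres_ext_pi s : pres_ext (pres_pi rel s) = aeval s.
Proof. by apply: aeval_pres_eq; apply: repr_pi. Qed.

Lemma pres_ext_gen g : pres_ext (gen rel g) = h g.
Proof. by rewrite /gen pres_ext_pi. Qed.

Lemma pres_ext1 : pres_ext 1 = 1.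
Proof. by rewrite -(pres_pi1 rel) pres_ext_pi /= scale1r. Qed.

Lemma pres_extM x y : pres_ext (x * y) = pres_ext x * pres_ext y.
Proof.
elim/pres_piW: x => s; elim/pres_piW: y => t.
by rewrite -pres_piM !pres_ext_pi.
Qed.

Lemma pres_ext_comb a x y : pres_ext (a *: x + y) = a *: pres_ext x + pres_ext y.
Proof.
have D u v : pres_ext (u + v) = pres_ext u + pres_ext v.
  by elim/pres_piW: u => s; elim/pres_piW: v => t; rewrite -pres_piD !pres_ext_pi.
(* Scaling by [a] is multiplication by the class of a constant, so homogeneity follows from
   multiplicativity. *)
by rewrite D -[x in LHS]mul1r pres_scalerAl -pres_piC pres_extM pres_ext_pi /=
  -pres_scalerAl mul1r.
Qed.

End Twist.

(** * Separation of the eigenspaces of a linear map *)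

Section Eigenspaces.
Context (K : fieldType) (G : Type) (rel : aterm K G -> aterm K G -> Prop).
Local Notation A := (presAlg rel).
Variables (phi : A -> A) (c : K).
Hypothesis phi_comb : forall a x y, phi (a *: x + y) = a *: phi x + phi y.

Let phi0 : phi 0 = 0.
Proof.
have := phi_comb (-1) 0 0; rewrite scaler0 addr0 scaleN1r addNr //.
Qed.

Definition sub_eigen (d : int) (x : A) := phi x - c ^ d *: x.
Definition sub_eigens (s : seq int) (x : A) := foldr sub_eigen x s.

Lemma sub_eigen_comb d a x y : sub_eigen d (a *: x + y) = a *: sub_eigen d x + sub_eigen d y.
Proof.
rewrite /sub_eigen phi_comb scalerDr opprD addrACA scalerBr !scalerA.
by rewrite (mulrC a).
Qed.

Lemma sub_eigens_comb s a x y :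
  sub_eigens s (a *: x + y) = a *: sub_eigens s x + sub_eigens s y.
Proof. by elim: s => //= d s ->; apply: sub_eigen_comb. Qed.

Lemma sub_eigens0 s : sub_eigens s 0 = 0.
Proof. by elim: s => //= d s ->; rewrite /sub_eigen phi0 scaler0 subr0. Qed.

(** Both sides are the same quadratic polynomial in [phi]. *)
Lemma sub_eigen_comm d d' x : sub_eigen d (sub_eigen d' x) = sub_eigen d' (sub_eigen d x).
Proof.
have phiB y a z : phi (y - a *: z) = phi y - a *: phi z.
  by rewrite addrC -scaleNr phi_comb scaleNr addrC.
rewrite /sub_eigen !phiB !scalerBr !opprB !scalerA (mulrC (c ^ d)).
rewrite -!addrA; congr (_ + _).
by rewrite addrCA [RHS]addrCA; congr (_ + _); rewrite addrC.
Qed.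

Lemma sub_eigens_swap s d x : sub_eigens s (sub_eigen d x) = sub_eigen d (sub_eigens s x).
Proof. by elim: s => //= e s ->; rewrite sub_eigen_comm. Qed.

Lemma sub_eigens_comm s s' x : sub_eigens s (sub_eigens s' x) = sub_eigens s' (sub_eigens s x).
Proof. by elim: s => //= d s ->; rewrite sub_eigens_swap. Qed.

(* The operators sub_eigens s with 0 \notin s kill the other eigenvectors but act
   invertibly on fixed points. *)
Lemma fixed_in_layer0 (E : int -> set A) :
  (forall d x, E d x -> phi x = c ^ d *: x) ->
  (forall d, d != 0 -> c ^ d != 1) -> subspace (E 0) ->
  forall x, lin_span [set x | exists d, E d x] x -> phi x = x -> E 0 x.
Proof.
move=> Ephi c1 E0 x.
(* [V] consists of the [x] that agree with an element of [E 0] up to something killed by a product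
   of the operators. It is closed under sums by concatenating the two lists, as the operators
   commute. *)
pose V := [set x | exists2 x0, E 0 x0
  & exists2 s : seq int, 0 \notin s & sub_eigens s (x - x0) = 0].
move=> Ex phix; have {Ex} : V x.
  move: x Ex {phix}; apply: lin_span_ind => [|x [d Ex]].
    split=> [|a x y [x0 Ex0 [s s0 e]] [y0 Ey0 [s' s0' e']]].
      exists 0; first by case: E0.
      by exists [::]; rewrite //= subr0.
    exists (a *: x0 + y0); first exact: E0.2.
    exists (s ++ s'); first by rewrite mem_cat negb_or s0.
    rewrite opprD addrACA -scalerBr sub_eigens_comb /sub_eigens !foldr_cat.
    rewrite -!/(sub_eigens _ _) e' sub_eigens0 sub_eigens_comm e sub_eigens0.
    by rewrite scaler0 addr0.
  case: (eqVneq d 0) Ex => [-> Ex|d0 Ex].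
    by exists x => //; exists [::]; rewrite //= subrr.
  exists 0; first by case: E0.
  exists [:: d]; first by rewrite inE eq_sym.
  by rewrite /= subr0 /sub_eigen (Ephi _ _ Ex) subrr.
case=> x0 Ex0 [s s0 e]; suff -> : x = x0 by [].
apply/eqP; rewrite -subr_eq0; apply/eqP.
have phi_fix : phi (x - x0) = x - x0.
  by rewrite addrC -scaleN1r phi_comb (Ephi _ _ Ex0) phix expr0z scale1r.
have fixE : sub_eigens s (x - x0) = (\prod_(d <- s) (1 - c ^ d)) *: (x - x0).
  elim: s {s0 e} => [|d s IH]; first by rewrite big_nil scale1r.
  have phiZ k : phi (k *: (x - x0)) = k *: (x - x0).
    by rewrite -[_ *: _]addr0 phi_comb phi0 phi_fix.
  by rewrite big_cons /= IH /sub_eigen phiZ -scalerA scalerBl scale1r.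
move: e; rewrite fixE => e.
have : \prod_(d <- s) (1 - c ^ d) != 0.
  rewrite prodf_seq_neq0; apply/allP => d ds /=; rewrite subr_eq0 eq_sym c1 //.
  by apply: contraNneq s0 => <-.
move: (\prod_(d <- s) _) e => k e k0.
by rewrite -[x - x0]scale1r -(mulVf k0) -scalerA e scaler0.
Qed.

End Eigenspaces.

(** * The defining relations of the double affine Hecke algebra, with natural numbers as indices *)

Section DahaIdentities.
Context (K : fieldType) (m : nat) (q tau : K).
Hypotheses (q0 : q != 0) (tau0 : tau != 0).
Local Notation H := (daha m.+2 q tau).

Local Notation b := (tau - tau^-1).
(* Indices start at 0, so that natT i is T_(i+1) and natX i is X_(i+1).  Indices out
   of range are mapped to 0 by inord. *)
Definition natT (i : nat) : H := @dT K m.+2 q tau (inord i : 'I_m.+1).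
Definition natTV (i : nat) : H := natT i - b *: (1 : H).
Definition natX (i : nat) : H := dX q tau (inord i : 'I_m.+2).
Definition natXV (i : nat) : H := dXV q tau (inord i : 'I_m.+2).
Definition natY (i : nat) : H := dY q tau (inord i : 'I_m.+2).
Definition natYV (i : nat) : H := dYV q tau (inord i : 'I_m.+2).
Definition natD (i : nat) : H := dD q tau (inord i : 'I_m.+2).
Local Notation T := natT.
Local Notation TV := natTV.
Local Notation X := natX.
Local Notation XV := natXV.
Local Notation Y := natY.
Local Notation YV := natYV.
Local Notation D := natD.

Lemma daha_relE s t : @daha_rel K m.+2 q tau s t ->
  pres_pi (@daha_rel K m.+2 q tau) s = pres_pi (@daha_rel K m.+2 q tau) t.
Proof. by move=> st; apply/pres_piP; apply: pe_rel. Qed.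

Lemma natT_quadratic i : T i * T i = b *: T i + 1.
Proof.
have := daha_relE (@rel_quadratic K m.+2 q tau (inord i : 'I_m.+1)).
rewrite !(pres_piD, pres_piM, pres_piC) -[pres_pi _ (Gen _)]/(T i).
rewrite scale0r scaleN1r mulN1r mulrDl mulrDr.
rewrite mulNr mulrDr -!pres_scalerAl -!pres_scalerAr !mulr1 !mul1r scalerA mulfV // scale1r.
move=> /eqP; rewrite subr_eq0 => /eqP e.
by rewrite scalerBl addrAC -e addrK.
Qed.

Lemma natTTV i : T i * TV i = 1.
Proof. by rewrite mulrBr natT_quadratic -pres_scalerAr mulr1 addrC addKr. Qed.

Lemma natTVT i : TV i * T i = 1.
Proof. by rewrite mulrBl natT_quadratic -pres_scalerAl mul1r addrC addKr. Qed.

Lemma natT_braid i : (i.+1 < m.+1)%N -> T i * T i.+1 * T i = T i.+1 * T i * T i.+1.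
Proof.
move=> im; have := @daha_relE _ _ (@rel_braid K m.+2 q tau (inord i : 'I_m.+1) (inord i.+1 : 'I_m.+1) _).
by rewrite !pres_piM; apply; rewrite !inordK // ltnW.
Qed.

Lemma natT_far i j : (i.+1 < j)%N -> (j < m.+1)%N -> T i * T j = T j * T i.
Proof.
move=> ij jm; have := @daha_relE _ _ (@rel_TT K m.+2 q tau (inord i : 'I_m.+1) (inord j : 'I_m.+1) _).
by rewrite !pres_piM; apply; rewrite !inordK ?ij //; lia.
Qed.

Lemma natTXT i : (i < m.+1)%N -> T i * X i * T i = X i.+1.
Proof.
move=> im; have := @daha_relE _ _ (@rel_TXT K m.+2 q tau (inord i : 'I_m.+1) (inord i) (inord i.+1) _ _).
by rewrite !pres_piM; apply; rewrite !inordK //; lia.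
Qed.

Lemma natTX0 i : (0 < i < m.+1)%N -> T i * X 0 = X 0 * T i.
Proof.
move=> im; have := @daha_relE _ _ (@rel_TX K m.+2 q tau (inord i : 'I_m.+1) (inord 0) _ _).
by rewrite !pres_piM; apply; rewrite !inordK //; lia.
Qed.

Lemma natTYT i : (i < m.+1)%N -> TV i * Y i * TV i = Y i.+1.
Proof.
move=> im; have := @daha_relE _ _ (@rel_TYT K m.+2 q tau (inord i : 'I_m.+1) (inord i) (inord i.+1) _ _).
rewrite !(pres_piM, pres_piD, pres_piC) scaleN1r mulN1r.
by apply; rewrite !inordK //; lia.
Qed.

Lemma natTY i j : (i < m.+1)%N -> (j < m.+2)%N -> j != i -> j != i.+1 ->
  T i * Y j = Y j * T i.
Proof.
move=> im jm ji ji'; have := @daha_relE _ _ (@rel_TY K m.+2 q tau (inord i : 'I_m.+1) (inord j) _ _).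
by rewrite !pres_piM; apply; rewrite !inordK //; lia.
Qed.

Lemma natYX : YV 1 * X 0 * Y 1 * XV 0 = T 0 * T 0.
Proof.
have := @daha_relE _ _ (@rel_YXYX K m.+2 q tau (inord 0 : 'I_m.+1) (inord 0) (inord 1) _ _ _).
by rewrite !pres_piM; apply; rewrite !inordK //; lia.
Qed.

Lemma natXXV i : X i * XV i = 1.
Proof. by have := daha_relE (rel_XXV q tau (inord i : 'I_m.+2)); rewrite !pres_piM. Qed.
Lemma natXVX i : XV i * X i = 1.
Proof. by have := daha_relE (rel_XVX q tau (inord i : 'I_m.+2)); rewrite !pres_piM. Qed.
Lemma natYYV i : Y i * YV i = 1.
Proof. by have := daha_relE (rel_YYV q tau (inord i : 'I_m.+2)); rewrite !pres_piM. Qed.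
Lemma natYVY i : YV i * Y i = 1.
Proof. by have := daha_relE (rel_YVY q tau (inord i : 'I_m.+2)); rewrite !pres_piM. Qed.
Lemma natXX i j : X i * X j = X j * X i.
Proof. by have := daha_relE (rel_XX q tau (inord i : 'I_m.+2) (inord j)); rewrite !pres_piM. Qed.
Lemma natYY i j : Y i * Y j = Y j * Y i.
Proof. by have := daha_relE (rel_YY q tau (inord i : 'I_m.+2) (inord j)); rewrite !pres_piM. Qed.

Lemma prod_enum_ord N (f : nat -> H) :
  \prod_(i <- enum 'I_N) f i = \prod_(0 <= i < N) f i.
Proof. by rewrite -(big_map val xpredT f) val_enum_ord -[N in iota 0 N]subn0. Qed.

Lemma natYprodX : (\prod_(0 <= i < m.+2) Y i) * X 0
  = q *: (X 0 * \prod_(0 <= i < m.+2) Y i).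
Proof.
have := daha_relE (rel_YprodX q tau (inord 0 : 'I_m.+2)).
rewrite !(pres_piM, pres_piC) -pres_scalerAl mul1r.
have -> : pres_pi (@daha_rel K m.+2 q tau)
    (foldr (fun i s => (Gen (Ygen i) * s)%AT) 1%:T%AT (enum 'I_m.+2))
    = \prod_(0 <= i < m.+2) Y i.
  rewrite -prod_enum_ord; elim: (enum _) => [|i e IH]; first by rewrite big_nil.
  by rewrite /= pres_piM IH big_cons /natY inord_val.
by [].
Qed.

(** Transfers a commutation relation to the inverses of the outer factors; used for passing from
    [T], [Y] and [rho] to [TV], [YV] and [rhoV]. *)
Lemma cancel_conj (a a' c c' z z' : H) :
  a * a' = 1 -> a' * a = 1 -> c * c' = 1 -> c' * c = 1 ->
  a * z = z' * c -> a' * z' = z * c'.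
Proof.
move=> aa' a'a cc' c'c e.
have -> : z' = a * z * c' by rewrite e -mulrA cc' mulr1.
by rewrite !mulrA a'a mul1r.
Qed.

(** * Ascending and descending products of the [T i], and the element [rho] *)

Fixpoint asc (j : nat) : H := if j is j.+1 then asc j * T j else 1.
Fixpoint desc (j : nat) : H := if j is j.+1 then T j * desc j else 1.
Fixpoint ascV (j : nat) : H := if j is j.+1 then TV j * ascV j else 1.
Fixpoint descV (j : nat) : H := if j is j.+1 then descV j * TV j else 1.
(** What is left of [desc j.+1] without its last factor [T 0]; up to [j = m] it commutes with
    [X 0]. *)
Fixpoint desc1 (j : nat) : H := if j is j.+1 then T j.+1 * desc1 j else 1.

Lemma asc_prod j : asc j = \prod_(0 <= i < j) T i.
Proof. by elim: j => [|j /= ->]; rewrite ?big_nil // big_nat_recr. Qed.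
Lemma ascK j : asc j * ascV j = 1.
Proof.
by elim: j => [|j IH] /=; rewrite ?mulr1 // -mulrA (mulrA (T j)) natTTV mul1r.
Qed.
Lemma ascVK j : ascV j * asc j = 1.
Proof.
by elim: j => [|j IH] /=; rewrite ?mulr1 // -mulrA (mulrA (ascV j)) IH mul1r natTVT.
Qed.
Lemma descK j : desc j * descV j = 1.
Proof.
by elim: j => [|j IH] /=; rewrite ?mulr1 // -mulrA (mulrA (desc j)) IH mul1r natTTV.
Qed.
Lemma descVK j : descV j * desc j = 1.
Proof.
by elim: j => [|j IH] /=; rewrite ?mulr1 // -mulrA (mulrA (TV j)) natTVT mul1r.
Qed.

Lemma desc_desc1 j : desc j.+1 = desc1 j * T 0.
Proof. by elim: j => [|j IH] /=; rewrite ?mulr1 ?mul1r // -mulrA -IH. Qed.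

Lemma desc_far i j : (j < i)%N -> (i < m.+1)%N -> desc j * T i = T i * desc j.
Proof.
elim: j => [|j IH] ji im /=; first by rewrite mulr1 mul1r.
by rewrite -mulrA (IH (ltnW ji) im) mulrA natT_far // mulrA.
Qed.

Lemma desc_shift i j : (i.+1 < j)%N -> (j <= m.+1)%N -> T i * desc j = desc j * T i.+1.
Proof.
elim: j => [//|j IH]; rewrite ltnS leq_eqVlt => /orP[/eqP <-|ij] jm /=.
  by rewrite !mulrA natT_braid // -!mulrA desc_far.
by rewrite mulrA natT_far // -mulrA (IH ij (ltnW jm)) mulrA.
Qed.

Lemma desc_desc1_shift k : (k <= m)%N -> desc m.+1 * desc1 k = desc k * desc m.+1.
Proof.
elim: k => [|k IH] km; first by rewrite mulr1 mul1r.
have -> : desc1 k.+1 = T k.+1 * desc1 k by [].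
have -> : desc k.+1 = T k * desc k by [].
by rewrite mulrA -desc_shift // -(mulrA (T k)) (IH (ltnW km)) mulrA.
Qed.

Lemma desc1_X0 k : (k <= m)%N -> desc1 k * X 0 = X 0 * desc1 k.
Proof.
elim: k => [|k IH] km /=; first by rewrite mulr1 mul1r.
by rewrite -mulrA (IH (ltnW km)) mulrA natTX0 ?mulrA.
Qed.

Lemma natX_desc_asc j : (j <= m.+1)%N -> X j = desc j * X 0 * asc j.
Proof.
elim: j => [|j IH] jm; first by rewrite mulr1 mul1r.
by rewrite -natTXT // (IH (ltnW jm)) /= !mulrA.
Qed.

(* Locked, as rewriting with mulrA would otherwise unfold them. *)
Definition rho : H := locked (desc m.+1 * X 0).
Definition rhoV : H := locked (asc m.+1 * XV m.+1).

Lemma rhoE : rho = desc m.+1 * X 0. Proof. by rewrite /rho -lock. Qed.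
Lemma rhoVE : rhoV = asc m.+1 * XV m.+1. Proof. by rewrite /rhoV -lock. Qed.

Lemma rho_asc : rho * asc m.+1 = X m.+1.
Proof. by rewrite rhoE -natX_desc_asc. Qed.

Lemma rhoK : rho * rhoV = 1.
Proof. by rewrite rhoVE mulrA rho_asc natXXV. Qed.

Lemma rhoVK : rhoV * rho = 1.
Proof.
have -> : rho = X m.+1 * ascV m.+1 by rewrite -rho_asc -(mulrA rho) ascK mulr1.
by rewrite rhoVE -(mulrA (asc _)) (mulrA (XV _)) natXVX mul1r ascK.
Qed.

Lemma natT_rho i : (i < m)%N -> T i * rho = rho * T i.+1.
Proof. by move=> im; rewrite rhoE mulrA desc_shift // -!mulrA natTX0. Qed.

Lemma rho_natT0 : rho * T 0 = desc1 m * X 1.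
Proof. by rewrite rhoE desc_desc1 -natTXT // !mulrA. Qed.

(** Both sides equal [desc m.+1 * desc1 m * X 1 * X 0]. *)
Lemma natT_rho2 : T m * (rho * rho) = rho * rho * T 0.
Proof.
have rTV : rho = desc1 m * X 1 * TV 0 by rewrite -rho_natT0 -mulrA natTTV mulr1.
have XTX : X 0 * T 0 * X 0 = TV 0 * X 1 * X 0.
  by rewrite -[X 1]natTXT // !mulrA natTVT mul1r.
(* Both sides are the square of [desc m.+1]: the left one because [desc1 m] becomes [desc m] when
   moved left past [desc m.+1]. *)
have dd : T m * (desc m.+1 * desc1 m) = desc m.+1 * desc1 m * T 0.
  transitivity (desc m.+1 * desc m.+1); first by rewrite desc_desc1_shift // mulrA.
  by rewrite -(mulrA (desc m.+1)) -desc_desc1.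
rewrite -(mulrA rho) rho_natT0.
have -> : rho * (desc1 m * X 1) = desc m.+1 * desc1 m * (X 1 * X 0).
  rewrite rhoE -(mulrA (desc m.+1) (X 0)) (mulrA (X 0) (desc1 m)) -desc1_X0 //.
  by rewrite -(mulrA (desc1 m)) (natXX 0) mulrA.
have -> : rho * rho = desc m.+1 * desc1 m * (TV 0 * X 1 * X 0).
  have rE : rho = desc1 m * T 0 * X 0 by rewrite rhoE desc_desc1.
  rewrite {2}rE -XTX rhoE -(mulrA (desc m.+1) (X 0)) !(mulrA (X 0)) -desc1_X0 //.
  by rewrite !mulrA.
rewrite mulrA dd -(mulrA _ (T 0)) !mulrA.
by rewrite -(mulrA _ (T 0) (TV 0)) natTTV mulr1.
Qed.

(** * Commutation of [rho] with the [Y i] *)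

Lemma natY_commute_shift i : (i < m.+1)%N -> T i * Y i.+1 * T i = Y i.
Proof.
move=> im; rewrite -natTYT // !mulrA natTTV mul1r -mulrA natTVT mulr1 //.
Qed.

(** For [i = 0] the relation [natYX] gives [X 0 * Y 1 = Y 1 * T 0 * T 0 * X 0], and [Y 0] commutes
    with [desc1 m]. The other cases follow by conjugating with [TV i], which [rho] carries to
    [TV i.+1]. *)
Lemma natY_rho i : (i < m.+1)%N -> Y i * rho = rho * Y i.+1.
Proof.
elim: i => [_|i IH im].
  have X0Y : X 0 * Y 1 = Y 1 * T 0 * T 0 * X 0.
    rewrite -(mulrA (Y 1)) -natYX !mulrA natYYV mul1r -(mulrA _ (XV 0)).
    by rewrite natXVX mulr1.
  have YT : Y 0 * T 0 = T 0 * Y 1 * T 0 * T 0 by rewrite natY_commute_shift.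
  rewrite rhoE -(mulrA (desc m.+1)) X0Y !desc_desc1.
  have e k : (k <= m)%N -> Y 0 * desc1 k = desc1 k * Y 0.
    elim: k => [|k IHk] km /=; first by rewrite mulr1 mul1r.
    by rewrite -(mulrA (T k.+1)) -(IHk (ltnW km)) !mulrA natTY.
  rewrite !mulrA e // -(mulrA (desc1 m)) YT.
  by rewrite !mulrA.
have rT : rho * TV i.+1 = TV i * rho.
  exact/esym/(cancel_conj (natTTV _) (natTVT _) (natTTV _) (natTVT _))/natT_rho.
rewrite -[Y i.+1]natTYT 1?ltnW // -[Y i.+2]natTYT //.
rewrite -(mulrA _ (TV i)) -rT (mulrA _ rho) -(mulrA (TV i)) (IH (ltnW im)).
by rewrite (mulrA (TV i)) -rT !mulrA.
Qed.

(** [T i] commutes with the [Y j] away from [i] and [i.+1], and with the product [Y i * Y i.+1]. *)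
Lemma natYprod_T i : (i < m.+1)%N ->
  GRing.comm (\prod_(0 <= j < m.+2) Y j) (T i).
Proof.
move=> im.
have far a c : (c <= i)%N || (i.+1 < a)%N -> (c <= m.+2)%N ->
    GRing.comm (T i) (\prod_(a <= j < c) Y j).
  move=> ac cm; rewrite big_seq; apply: commr_prod => j.
  by rewrite mem_index_iota => ?; apply: natTY; lia.
have -> : \prod_(0 <= j < m.+2) Y j
    = \prod_(0 <= j < i) Y j * (Y i * (Y i.+1 * \prod_(i.+2 <= j < m.+2) Y j)).
  by rewrite -!big_ltn -?big_cat_nat //=; lia.
apply/commr_sym/commrM; first by apply: far; lia.
rewrite mulrA; apply: commrM; last by apply: far; lia.
have TY : T i * Y i.+1 = Y i * TV i.
  by rewrite -[Y i](natY_commute_shift im) -!mulrA natTTV mulr1.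
have YT : Y i.+1 * T i = TV i * Y i.
  by rewrite -[Y i](natY_commute_shift im) !mulrA natTVT mul1r.
by rewrite /GRing.comm natYY mulrA TY -[in RHS]natYY -mulrA -mulrA YT.
Qed.

(** The product of all [Y i] commutes with [rho] up to [q], and [natY_rho] accounts for all its
    factors but the last. Cancelling the invertible product of [Y 1] to [Y m.+1] leaves the
    claim. *)
Lemma natYlast_rho : Y m.+1 * rho = q *: (rho * Y 0).
Proof.
have Ydesc j : (j <= m.+1)%N -> GRing.comm (\prod_(0 <= i < m.+2) Y i) (desc j).
  elim: j => [|j IH] jm; first exact: commr1.
  by apply: commrM (natYprod_T _) (IH (ltnW jm)).
have Yrho : (\prod_(0 <= i < m.+2) Y i) * rho = q *: (rho * \prod_(0 <= i < m.+2) Y i).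
  by rewrite rhoE mulrA Ydesc // -mulrA natYprodX -pres_scalerAr !mulrA.
have shift k : (k <= m.+1)%N ->
    (\prod_(0 <= i < k) Y i) * rho = rho * \prod_(0 <= i < k) Y i.+1.
  elim: k => [|k IH] km; first by rewrite !big_nil mul1r mulr1.
  by rewrite !big_nat_recr //= -mulrA natY_rho // mulrA (IH (ltnW km)) mulrA.
have [w Yw] : exists w, (\prod_(0 <= i < m.+1) Y i.+1) * w = 1.
  apply: (big_ind (fun x : H => exists w, x * w = 1)) => [|x y [w e] [w' e']|i _].
  - by exists 1; rewrite mulr1.
  - by exists (w' * w); rewrite -mulrA (mulrA y) e' mul1r.
  - by exists (YV i.+1); apply: natYYV.
have Ylast : \prod_(0 <= i < m.+2) Y i = Y m.+1 * \prod_(0 <= i < m.+1) Y i.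
  rewrite big_nat_recr //=; apply: commr_sym; apply: commr_prod => i _; exact: natYY.
rewrite -[LHS]mulr1 -[RHS]mulr1 -Yw mulrA -(mulrA (Y m.+1)) -shift //.
rewrite mulrA -Ylast Yrho big_nat_recl //.
by rewrite -!pres_scalerAl !mulrA.
Qed.

Lemma natYV_rho i : (i < m.+1)%N -> YV i * rho = rho * YV i.+1.
Proof.
by move/natY_rho; apply: cancel_conj; rewrite ?natYYV ?natYVY.
Qed.

Lemma natYVlast_rho : YV m.+1 * rho = q^-1 *: (rho * YV 0).
Proof.
have e : Y m.+1 * rho = rho * (q *: Y 0) by rewrite natYlast_rho -pres_scalerAr.
rewrite pres_scalerAr; apply: cancel_conj e; rewrite ?natYYV ?natYVY //.
all: by rewrite -pres_scalerAr -pres_scalerAl scalerA ?natYYV ?natYVY ?mulfV ?mulVf // scale1r.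
Qed.

(** * Bernstein-Lusztig relations between [T i] and the [Y j], [YV j] *)

Lemma natTV_E i : TV i = T i - b *: (1 : H). Proof. by []. Qed.

Lemma natTVl i x : TV i * x = T i * x - b *: x.
Proof. by rewrite natTV_E mulrBl -pres_scalerAl mul1r. Qed.

Lemma natTVr i x : x * TV i = x * T i - b *: x.
Proof. by rewrite natTV_E mulrBr -pres_scalerAr mulr1. Qed.

Lemma natYS_T i : (i < m.+1)%N -> Y i.+1 * T i = T i * Y i - b *: Y i.
Proof. by move=> im; rewrite -natTVl -natTYT // -mulrA natTVT mulr1. Qed.

Lemma natY_T i : (i < m.+1)%N -> Y i * T i = T i * Y i.+1 + b *: Y i.
Proof.
move=> im; apply/eqP; rewrite -subr_eq -natTVr; apply/eqP.
by rewrite -natTYT // !mulrA natTTV mul1r.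
Qed.

Lemma natYVS_T i : (i < m.+1)%N -> YV i.+1 * T i = T i * YV i + b *: YV i.+1.
Proof.
move=> im; apply/eqP; rewrite -subr_eq -natTVr; apply/eqP.
have e : Y i.+1 * T i = TV i * Y i by rewrite natTVl natYS_T.
by apply: cancel_conj e; rewrite ?natYYV ?natYVY.
Qed.

Lemma natYV_T i : (i < m.+1)%N -> YV i * T i = T i * YV i.+1 - b *: YV i.+1.
Proof.
move=> im; rewrite -natTVl; have e : Y i * TV i = T i * Y i.+1.
  by rewrite natTVr natY_T // addrK.
by apply: cancel_conj e; rewrite ?natYYV ?natYVY.
Qed.

Lemma natTYV i j : (i < m.+1)%N -> (j < m.+2)%N -> j != i -> j != i.+1 ->
  T i * YV j = YV j * T i.
Proof.
move=> im jm ji ji'; apply: esym.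
by apply: cancel_conj (esym (natTY im jm ji ji')); rewrite ?natYYV ?natYVY.
Qed.

(** * The element [down] and its exchange with [rho] *)

Lemma last_ord_inord (i : 'I_m.+2) : last_ord i = inord m.+1.
Proof. by apply: val_inj; rewrite /= inordK. Qed.

Definition Dn : H := (q - q^-1)^-1 *: (XV m.+1 * (Y m.+1 - YV m.+1)).

Lemma prod_rev_enum N : \prod_(i <- rev (enum 'I_N)) T i = desc N.
Proof.
rewrite -(big_map val xpredT T) map_rev val_enum_ord.
elim: N => [|N IH]; first by rewrite big_nil.
have -> : iota 0 N.+1 = iota 0 N ++ [:: N] by rewrite -addn1 iotaD.
by rewrite rev_cat big_cons IH.
Qed.

Lemma natD0 : D 0 = asc m.+1 * Dn * desc m.+1.
Proof.
rewrite /natD /dD last_ord_inord -prod_rev_enum asc_prod -prod_enum_ord.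
congr (_ * _ * _).
  by apply: eq_big => i; rewrite ?inordK // /natT inord_val.
by apply: eq_big => i; rewrite ?inordK // /natT inord_val.
Qed.

Definition fYn : H := (q - q^-1)^-1 *: (Y m.+1 - YV m.+1).
(** The element v of the overview; by [down_Dn] and [natD0] it is [D 0] up to the unit
    [desc m.+1]. *)
Definition down : H := rhoV * fYn.

Lemma down_Dn : down = asc m.+1 * Dn.
Proof. by rewrite /down /fYn rhoVE /Dn -!pres_scalerAr mulrA. Qed.

Lemma rho_down : rho * down = fYn.
Proof. by rewrite mulrA rhoK mul1r. Qed.

(** The outer factors [desc1 m] and [descV m.+1] are units, so this product is e_21 up to units. *)
Lemma rho_T0_down : rho * T 0 * down = desc1 m * (X 1 * D 0) * descV m.+1.
Proof.
rewrite rho_natT0 down_Dn natD0 -!(mulrA (desc1 m)) -(mulrA (X 1)).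
by rewrite -(mulrA (_ * Dn)) descK mulr1.
Qed.

Lemma down_rho : down * rho = (q - q^-1)^-1 *: (q *: Y 0 - q^-1 *: YV 0).
Proof.
rewrite /down /fYn -mulrA -pres_scalerAl -pres_scalerAr mulrBl.
rewrite natYlast_rho natYVlast_rho mulrBr -!pres_scalerAr !mulrA rhoVK.
by rewrite !mul1r.
Qed.

(** [fYn] is moved past [T m] by the Bernstein-Lusztig relations. In the main term [rho] then turns
    [Y m - YV m] into [Y m.+1 - YV m.+1], and [rhoV * T m * rho = rho * T 0 * rhoV] by [natT_rho2].
    In the remaining term [rhoV] and [rho] cancel. *)
Lemma exchange_T : down * T m * rho = rho * T 0 * down
  + (- ((q - q^-1)^-1 * b)) *: (Y m.+1 + q^-1 *: YV 0).
Proof.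
set c := (q - q^-1)^-1.
have wT : fYn * T m = T m * (c *: (Y m - YV m)) - (c * b) *: (Y m + YV m.+1).
  rewrite /fYn -/c -pres_scalerAl -pres_scalerAr mulrBl mulrBr natYS_T // natYVS_T //.
  rewrite -scalerA -[RHS]scalerBr; congr (_ *: _).
  by rewrite scalerDr !opprD addrACA.
have wr : (c *: (Y m - YV m)) * rho = rho * fYn.
  by rewrite /fYn -/c -pres_scalerAl -pres_scalerAr mulrBl mulrBr natY_rho // natYV_rho.
have TrT : rhoV * T m * rho = rho * T 0 * rhoV.
  rewrite -[LHS]mulr1 -rhoK -!mulrA (mulrA rho rho) (mulrA (T m)) natT_rho2.
  by rewrite !mulrA rhoVK mul1r.
rewrite {1}/down -(mulrA rhoV) wT mulrBr mulrBl; congr (_ + _).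
  by rewrite -mulrA -(mulrA (T m)) wr !mulrA TrT.
rewrite scaleNr; congr (- _).
rewrite -pres_scalerAr -pres_scalerAl -mulrA mulrDl natY_rho // natYVlast_rho.
by rewrite (pres_scalerAr q^-1 rho) -mulrDr mulrA rhoVK mul1r.
Qed.

(** * The affine Hecke algebra and its double cosets *)

Definition polY : set H := subalg (range (@dY K m.+2 q tau) `|` range (@dYV K m.+2 q tau)).
Definition affH : set H := subalg
  (range (@dY K m.+2 q tau) `|` range (@dYV K m.+2 q tau) `|` range (@dT K m.+2 q tau)).

Lemma affH_subalg : is_subalg affH. Proof. exact: subalg_is_subalg. Qed.
Lemma affH_subspace : subspace affH. Proof. exact: subalg_subspace. Qed.
Lemma affHM x y : affH x -> affH y -> affH (x * y). Proof. exact: subalgM. Qed.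
Lemma affH1 : affH 1. Proof. exact: subalg1. Qed.

Lemma affH_T i : affH (T i).
Proof. by apply: subalg_gen; right; exists (inord i : 'I_m.+1). Qed.
Lemma polY_Y i : polY (Y i).
Proof. by apply: subalg_gen; left; apply: imageT. Qed.
Lemma polY_YV i : polY (YV i).
Proof. by apply: subalg_gen; right; apply: imageT. Qed.
Lemma polY_affH : polY `<=` affH.
Proof. by apply: subalg_sub => x Px; apply: subalg_gen; left. Qed.
Lemma affH_Y i : affH (Y i). Proof. by apply: polY_affH; apply: polY_Y. Qed.
Lemma affH_YV i : affH (YV i). Proof. by apply: polY_affH; apply: polY_YV. Qed.

Lemma affH_TV i : affH (TV i).
Proof.
apply: (subspaceB affH_subspace (affH_T i)).
exact: (subspaceZ _ affH_subspace affH1).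
Qed.

Lemma affH_asc j : affH (asc j).
Proof. by elim: j => [|j IH]; [exact: affH1 | apply: affHM IH (affH_T _)]. Qed.
Lemma affH_ascV j : affH (ascV j).
Proof. by elim: j => [|j IH]; [exact: affH1 | apply: affHM (affH_TV _) IH]. Qed.
Lemma affH_desc j : affH (desc j).
Proof. by elim: j => [|j IH]; [exact: affH1 | apply: affHM (affH_T _) IH]. Qed.
Lemma affH_descV j : affH (descV j).
Proof. by elim: j => [|j IH]; [exact: affH1 | apply: affHM IH (affH_TV _)]. Qed.
Lemma affH_desc1 j : affH (desc1 j).
Proof. by elim: j => [|j IH]; [exact: affH1 | apply: affHM (affH_T _) IH]. Qed.

(** A weak form of the Bernstein-Lusztig relation that only records where the coefficients lie; in
    this form it is stable under products. *)
Lemma polY_T k r : (k < m.+1)%N -> polY r ->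
  exists r1 r2, [/\ polY r1, polY r2 & r * T k = T k * r1 + r2].
Proof.
move=> km; have sP : subspace polY by apply: subalg_subspace.
have P0 : polY 0 by case: sP.
have P1 : polY 1 by apply: subalg1.
have PM x y : polY x -> polY y -> polY (x * y) by apply: subalgM.
(* Membership in [polY] is carried along because the remainder of [x * y] contains [x] itself. *)
move: r; suff: polY `<=` [set r | polY r /\ exists r1 r2, [/\ polY r1, polY r2 & r * T k = T k * r1 + r2]].
  by move=> PS r /PS[].
apply: subalg_ind => [|r gr].
  split; first by split=> //; exists 1, 0; rewrite mul1r mulr1 addr0.
    split; first by split=> //; exists 0, 0; rewrite mul0r mulr0 addr0.
    move=> a x y [Px [x1 [x2 [Px1 Px2 ex]]]] [Py [y1 [y2 [Py1 Py2 ey]]]].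
    split; first exact: sP.2.
    exists (a *: x1 + y1), (a *: x2 + y2); split; try exact: sP.2.
    by rewrite mul_combr ex ey mul_combl scalerDr addrACA.
  move=> x y [Px [x1 [x2 [Px1 Px2 ex]]]] [Py [y1 [y2 [Py1 Py2 ey]]]].
  split; first exact: PM.
  exists (x1 * y1), (x2 * y1 + x * y2); split; first exact: PM.
    by apply: (@subspaceD _ _ _ polY) => //; apply: PM.
  by rewrite -mulrA ey mulrDr mulrA ex mulrDl !mulrA addrA.
split; first exact: subalg_gen.
have PbY i : polY (b *: Y i) by apply: (subspaceZ _ sP (polY_Y _)).
have PbYV i : polY (b *: YV i) by apply: (subspaceZ _ sP (polY_YV _)).
have PN x : polY x -> polY (- x).
  by move=> Px; rewrite -[- x]add0r; apply: (subspaceB sP).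
have [PY PYV] := (polY_Y, polY_YV).
case: gr => -[j _ <-].
  rewrite -[j]inord_val -/(Y j).
  case: (eqVneq (val j) k) => [->|jk].
    by exists (Y k.+1), (b *: Y k); rewrite natY_T.
  case: (eqVneq (val j) k.+1) => [->|jk1].
    by exists (Y k), (- (b *: Y k)); rewrite natYS_T //; split=> //; apply: PN.
  by exists (Y j), 0; rewrite natTY ?addr0.
rewrite -[j]inord_val -/(YV j).
case: (eqVneq (val j) k) => [->|jk].
  by exists (YV k.+1), (- (b *: YV k.+1)); rewrite natYV_T //; split=> //; apply: PN.
case: (eqVneq (val j) k.+1) => [->|jk1].
  by exists (YV k), (b *: YV k.+1); rewrite natYVS_T.
by exists (YV j), 0; rewrite natTYV ?addr0.
Qed.

(** The span is stable under right multiplication by the generators: a [Y] is absorbed by [r], and a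
    [T k] is moved past [r] by [polY_T]. *)
Lemma affH_decomp : affH `<=` lin_span
  [set x | exists2 h, subalg [set T i | i in [set i | i < m.+1]%N] h
         & exists2 r, polY r & x = h * r].
Proof.
set S := subalg [set T i | i in _].
apply: subalg_mulr_ind; first exact: lin_span_subspace.
  apply: lin_span_gen; exists 1; first exact: subalg1.
  by exists 1; [exact: subalg1 | rewrite mulr1].
move=> x s Vx Ss; rewrite -[x]mul1r; move: x Vx.
apply: lin_span_mul; first exact: lin_span_subspace.
move=> x [h Sh [r Pr ->]]; rewrite mul1r -mulrA.
case: Ss => [Ys|[k _ <-]].
  apply: lin_span_gen; exists h => //; exists (r * s) => //.
  by apply: subalgM => //; apply: subalg_gen.
have [r1 [r2 [Pr1 Pr2 e]]] := polY_T (ltn_ord k) Pr.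
rewrite (_ : dT q tau k = T k); last by rewrite /natT inord_val.
rewrite e mulrDr; apply: (subspaceD (@lin_span_subspace _ _ _ _)); last first.
  by apply: lin_span_gen; exists h => //; exists r2.
apply: lin_span_gen; exists (h * T k); last by exists r1; rewrite ?mulrA.
by apply: subalgM => //; apply: subalg_gen; exists (val k) => //; apply: (ltn_ord k).
Qed.

(* t is either T or T read backwards. *)
Lemma affH_double_coset (t : nat -> H) :
  (forall i, (i < m.+1)%N -> t i * t i = b *: t i + 1) ->
  (forall i, (i.+1 < m.+1)%N -> t i * t i.+1 * t i = t i.+1 * t i * t i.+1) ->
  (forall i j, (i.+1 < j)%N -> (j < m.+1)%N -> t i * t j = t j * t i) ->
  [set T i | i in [set i | i < m.+1]%N] `<=` [set t i | i in [set i | i < m.+1]%N] ->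
  let P := subalg ([set t i | i in [set i | 0 < i < m.+1]%N]
     `|` range (@dY K m.+2 q tau) `|` range (@dYV K m.+2 q tau)) in
  affH `<=` lin_span
    [set x | P x \/ exists2 p, P p & exists2 p', P p' & x = p * t 0 * p'].
Proof.
move=> tquad tbraid tfar Tt P.
have polP : polY `<=` P.
  by apply: subalg_sub => x [Yx|Yx]; apply: subalg_gen; [left; right|right].
have parP : parabolic m.+1 t `<=` P.
  by apply: subalg_sub => x tx; apply: subalg_gen; left; left.
have PM x y : P x -> P y -> P (x * y) by apply: subalgM.
move=> x /affH_decomp; move: x; apply: lin_span_ind.
  exact: lin_span_subspace.
move=> x [h Sh [r Pr ->]].
have {}Sh : subalg [set t i | i in [set i | i < m.+1]%N] h.
  by move: h Sh; apply: subalg_sub => h Th; apply: subalg_gen; apply: Tt.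
(* The finite factor is decomposed; [r] is absorbed on the right, as [P] contains [polY]. *)
have Dh := hecke_double_coset tquad tbraid tfar Sh.
rewrite -[h]mul1r; move: h Dh {Sh}; apply: lin_span_mul; first exact: lin_span_subspace.
move=> h Hh; rewrite mul1r; apply: lin_span_gen.
case: Hh => [Ph|[p Pp [p' Pp' ->]]].
  by left; apply: (PM _ _ (parP _ _) (polP _ _)).
right; exists p; first exact: parP.
by exists (p' * r); [apply: (PM _ _ (parP _ _) (polP _ _)) | rewrite !mulrA].
Qed.

(** * Moving [rho] and [down] past elements of the affine Hecke algebra *)

Lemma fYn_Y j : GRing.comm fYn (Y j).
Proof.
rewrite /GRing.comm /fYn -pres_scalerAl -pres_scalerAr mulrBl mulrBr natYY.
congr (_ *: (_ - _)).
exact: (cancel_conj (natYYV _) (natYVY _) (natYYV _) (natYVY _) (natYY _ _)).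
Qed.

Lemma fYn_YV j : GRing.comm fYn (YV j).
Proof.
by apply: esym; apply: cancel_conj (esym (fYn_Y j)); rewrite ?natYYV ?natYVY.
Qed.

Lemma fYn_T i : (i < m)%N -> GRing.comm fYn (T i).
Proof.
move=> im; rewrite /GRing.comm /fYn -pres_scalerAl -pres_scalerAr mulrBl mulrBr.
by rewrite natTY ?natTYV //; lia.
Qed.

Lemma commute_scale a (x y : H) : GRing.comm x y -> GRing.comm x (a *: y).
Proof. by move=> xy; rewrite /GRing.comm -pres_scalerAl -pres_scalerAr xy. Qed.

(** Since [down = rhoV * fYn], a relation for [rho] passes to [down] once the shifted element
    commutes with [fYn]. *)
Lemma semicommute_down_l p g : GRing.comm fYn g -> rho * p = g * rho -> p * down = down * g.
Proof.
move=> wg e; rewrite /down -mulrA wg mulrA mulrA.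
by rewrite -(cancel_conj rhoK rhoVK rhoK rhoVK e).
Qed.

Lemma semicommute_down_r p g : GRing.comm fYn p -> p * rho = rho * g -> down * p = g * down.
Proof.
move=> wp e; rewrite /down -mulrA wp !mulrA.
by rewrite (cancel_conj rhoK rhoVK rhoK rhoVK (esym e)).
Qed.

(** Conjugation by [rho] shifts the indices cyclically, with a power of [q] at the wrap-around. The
    commutation with [fYn] is recorded for [semicommute_down_l]. *)
Lemma rho_Y j : (j < m.+2)%N -> exists g, [/\ affH g, GRing.comm fYn g & rho * Y j = g * rho].
Proof.
case: j => [|j] jm; last first.
  by exists (Y j); split; [exact: affH_Y | exact: fYn_Y | rewrite natY_rho].
exists (q^-1 *: Y m.+1); split.
- exact: (subspaceZ _ affH_subspace (affH_Y _)).
- exact/commute_scale/fYn_Y.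
- by rewrite -pres_scalerAl natYlast_rho scalerA mulVf // scale1r.
Qed.

Lemma rho_YV j : (j < m.+2)%N -> exists g, [/\ affH g, GRing.comm fYn g & rho * YV j = g * rho].
Proof.
case: j => [|j] jm; last first.
  by exists (YV j); split; [exact: affH_YV | exact: fYn_YV | rewrite natYV_rho].
exists (q *: YV m.+1); split.
- exact: (subspaceZ _ affH_subspace (affH_YV _)).
- exact/commute_scale/fYn_YV.
- by rewrite -pres_scalerAl natYVlast_rho scalerA mulfV // scale1r.
Qed.

Lemma Y_rho j : (j < m.+2)%N -> exists2 g, affH g & Y j * rho = rho * g.
Proof.
move=> jm; case: (eqVneq j m.+1) => [->|jm1].
  exists (q *: Y 0); first exact: (subspaceZ _ affH_subspace (affH_Y _)).
  by rewrite natYlast_rho pres_scalerAr.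
by exists (Y j.+1); [exact: affH_Y | rewrite natY_rho //; lia].
Qed.

Lemma YV_rho j : (j < m.+2)%N -> exists2 g, affH g & YV j * rho = rho * g.
Proof.
move=> jm; case: (eqVneq j m.+1) => [->|jm1].
  exists (q^-1 *: YV 0); first exact: (subspaceZ _ affH_subspace (affH_YV _)).
  by rewrite natYVlast_rho pres_scalerAr.
by exists (YV j.+1); [exact: affH_YV | rewrite natYV_rho //; lia].
Qed.

(** * The products [rho * f * down] and [down * f * rho] *)

Definition affTaff : set H := lin_span
  [set x | affH x \/ exists2 g, affH g & exists2 h, affH h & x = g * (rho * T 0 * down) * h].

Lemma affH_fYn : affH fYn.
Proof.
apply: (subspaceZ _ affH_subspace); apply: (subspaceB affH_subspace).
  exact: affH_Y.
exact: affH_YV.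
Qed.

(** [sandwich] for the parabolic subalgebra omitting [T 0], past which [rho] and [down] move. The
    middle term is [rho * T 0 * down] itself, so the correction is [0]. *)
Lemma rho_affH_down f : affH f -> affTaff (rho * f * down).
Proof.
pose P := subalg ([set T i | i in [set i | 0 < i < m.+1]%N]
     `|` range (@dY K m.+2 q tau) `|` range (@dYV K m.+2 q tau)).
have PE p : P p -> exists2 g, affH g & rho * p = g * rho.
  have sP := semicommute_subalg rho affH_subalg.
  move: p; apply: (subalg_ind sP) => p [[[[//|i] /= im <-]|[j _ <-]]|[j _ <-]].
  - by exists (T i); [exact: affH_T | rewrite natT_rho].
  - have [g [Fg _ e]] := rho_Y (ltn_ord j).
    by exists g; rewrite // -e /natY inord_val.
  - have [g [Fg _ e]] := rho_YV (ltn_ord j).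
    by exists g; rewrite // -e /natYV inord_val.
have PD p : P p -> exists2 g, affH g & p * down = down * g.
  have sP := semicommuter_subalg down affH_subalg.
  move: p; apply: (subalg_ind sP) => p [[[[//|i] /= im <-]|[j _ <-]]|[j _ <-]].
  - exists (T i); first exact: affH_T.
    by apply: semicommute_down_l; [exact: fYn_T | rewrite natT_rho].
  - have [g [Fg wg e]] := rho_Y (ltn_ord j); exists g => //.
    by apply: semicommute_down_l; rewrite // -e /natY inord_val.
  - have [g [Fg wg e]] := rho_YV (ltn_ord j); exists g => //.
    by apply: semicommute_down_l; rewrite // -e /natYV inord_val.
apply: (@sandwich _ _ _ affH affH_subalg P rho down (T 0) _ 0) => //.
- apply: subalg_sub => p [[[i _ <-]|Yp]|Yp]; first exact: affH_T.
    by apply: subalg_gen; left; left.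
  by apply: subalg_gen; left; right.
- exact: subalg_is_subalg.
- by apply: affH_double_coset => //;
    [move=> i _; apply: natT_quadratic | exact: natT_braid | exact: natT_far].
- by rewrite rho_down; apply: affH_fYn.
- by rewrite addr0.
- by case: affH_subspace.
Qed.

Lemma affH_exchange_term :
  affH ((- ((q - q^-1)^-1 * b)) *: (Y m.+1 + q^-1 *: YV 0)).
Proof.
apply: (subspaceZ _ affH_subspace); apply: (subspaceD affH_subspace).
  exact: affH_Y.
by apply: (subspaceZ _ affH_subspace); apply: affH_YV.
Qed.

(** [sandwich] for the parabolic subalgebra omitting [T m]. Reversing the numbering by [t] makes
    [T m] the generator [t 0], and the correction is that of [exchange_T]. *)
Lemma down_affH_rho f : affH f -> affTaff (down * f * rho).
Proof.
pose t i := T (m - i).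
pose P := subalg ([set t i | i in [set i | 0 < i < m.+1]%N]
     `|` range (@dY K m.+2 q tau) `|` range (@dYV K m.+2 q tau)).
have PE p : P p -> exists2 g, affH g & down * p = g * down.
  have sP := semicommute_subalg down affH_subalg.
  move: p; apply: (subalg_ind sP) => p [[[i /= im <-]|[j _ <-]]|[j _ <-]].
  (* As [i > 0], the index [m - i] is below [m], as [fYn_T] and [natT_rho] require. *)
  - exists (T (m - i).+1); first exact: affH_T.
    by apply: semicommute_down_r; [apply: fYn_T; lia | apply: natT_rho; lia].
  - have [g Fg e] := Y_rho (ltn_ord j); exists g => //.
    by move: e; rewrite /natY inord_val; apply: semicommute_down_r; rewrite -[j]inord_val; apply: fYn_Y.
  - have [g Fg e] := YV_rho (ltn_ord j); exists g => //.
    by move: e; rewrite /natYV inord_val; apply: semicommute_down_r; rewrite -[j]inord_val; apply: fYn_YV.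
have PD p : P p -> exists2 g, affH g & p * rho = rho * g.
  have sP := semicommuter_subalg rho affH_subalg.
  move: p; apply: (subalg_ind sP) => p [[[i /= im <-]|[j _ <-]]|[j _ <-]].
  - by exists (T (m - i).+1); [exact: affH_T | apply: natT_rho; lia].
  - have [g Fg e] := Y_rho (ltn_ord j).
    by exists g; rewrite // -e /natY inord_val.
  - have [g Fg e] := YV_rho (ltn_ord j).
    by exists g; rewrite // -e /natYV inord_val.
apply: (@sandwich _ _ _ affH affH_subalg P down rho (T m) _ _ _ _ PE PD _ _ exchange_T
  affH_exchange_term).
- apply: subalg_sub => p [[[i _ <-]|Yp]|Yp]; first exact: affH_T.
    by apply: subalg_gen; left; left.
  by apply: subalg_gen; left; right.
- exact: subalg_is_subalg.
- rewrite -[m in T m]subn0; apply: affH_double_coset.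
  + by move=> i _; apply: natT_quadratic.
  + move=> i im; rewrite /t (_ : (m - i = (m - i.+1).+1)%N); last by lia.
    by rewrite natT_braid //; lia.
  + by move=> i j ij jm; apply: esym; apply: natT_far; lia.
  + move=> _ [i /= im <-]; exists (m - i)%N => /=; first by lia.
    by rewrite /t subKn.
- rewrite down_rho; apply: (subspaceZ _ affH_subspace); apply: (subspaceB affH_subspace).
    by apply: (subspaceZ _ affH_subspace); apply: affH_Y.
  by apply: (subspaceZ _ affH_subspace); apply: affH_YV.
Qed.

(** * The layers and their stability under the generators of A *)

Local Notation B := (Hgl m.+2 q tau).

Lemma Hgl_subalg : is_subalg B. Proof. exact: subalg_is_subalg. Qed.

Lemma affH_Hgl : affH `<=` B.
Proof.
apply: subalg_sub => x [[Yx|Yx]|Tx]; apply: subalg_gen.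
- by left; left; right.
- by left; right.
- by left; left; left.
Qed.

(** By [rho_T0_down], the middle factor is the generator e_21, that is [X 1 * D 0], between elements
    of [affH]. *)
Lemma affTaff_Hgl : affTaff `<=` B.
Proof.
have [_ sB BM] := Hgl_subalg.
apply: lin_span_ind => // x [/affH_Hgl //|[g Fg [h Fh ->]]].
apply: (BM); last exact: affH_Hgl.
apply: (BM); first exact: affH_Hgl.
rewrite rho_T0_down; apply: (BM); last by apply: affH_Hgl; apply: affH_descV.
apply: (BM); first by apply: affH_Hgl; apply: affH_desc1.
apply: subalg_gen; right; exists (inord 1, inord 0) => //=.
by apply/eqP => /(congr1 val); rewrite /= !inordK.
Qed.

Lemma affTaff_exchange_down : affTaff `<=` exchange affH down rho.
Proof.
apply: lin_span_ind; first exact: lin_span_subspace.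
move=> x [Fx|[g Fg [h Fh ->]]]; apply: lin_span_gen; first by left.
right; exists g => //; exists (T 0); first exact: affH_T.
by exists h; rewrite // !mulrA.
Qed.

(** [exchange_T] is read from right to left; its correction stays in [affH]. *)
Lemma affTaff_exchange_rho : affTaff `<=` exchange affH rho down.
Proof.
apply: lin_span_ind; first exact: lin_span_subspace.
move=> x [Fx|[g Fg [h Fh ->]]]; first by apply: lin_span_gen; left.
have -> : rho * T 0 * down = down * T m * rho
    - (- ((q - q^-1)^-1 * b)) *: (Y m.+1 + q^-1 *: YV 0).
  by rewrite exchange_T addrK.
rewrite mulrBr mulrBl; apply: (subspaceB (@lin_span_subspace _ _ _ _)).
  apply: lin_span_gen; right; exists g => //; exists (T m); first exact: affH_T.
  by exists h; rewrite // !mulrA.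
apply: lin_span_gen; left; apply: affHM => //; apply: affHM => //.
exact: affH_exchange_term.
Qed.

(** [Negz k] is -(k+1), hence the height [k.+1]. The two ladders share the layer 0, which is [B]. *)
Definition layer (d : int) : set H :=
  match d with Posz k => ladder affH B rho k | Negz k => ladder affH B down k.+1 end.

Lemma layer_mull d f x : affH f -> layer d x -> layer d (f * x).
Proof.
by case: d => k; apply: (ladder_mull affH_subalg Hgl_subalg affH_Hgl).
Qed.

(** On nonnegative layers [rho] climbs its own ladder; on negative ones it removes one factor
    [down], reaching [B] from layer -1. *)
Lemma layer_rho d x : layer d x -> layer (d + 1) (rho * x).
Proof.
case: d => k Lx; first by rewrite -PoszD addn1; apply: (ladder_up affH_subalg).
have : ladder affH B down k (rho * x).
  apply: (ladder_down affH_subalg Hgl_subalg affH_Hgl _ _ Lx) => f Ff.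
    by apply: affTaff_Hgl; apply: rho_affH_down.
  by apply: affTaff_exchange_rho; apply: rho_affH_down.
case: k {Lx} => [|k] Lx.
  by rewrite (_ : Negz 0 + 1 = 0)%R.
rewrite (_ : Negz k.+1 + 1 = Negz k)%R; [exact: Lx | lia].
Qed.

Lemma layer_down d x : layer d x -> layer (d - 1) (down * x).
Proof.
case: d => [[|k]|k] Lx.
- exact: (ladder_up affH_subalg (k := 0)).
- have : ladder affH B rho k (down * x).
    apply: (ladder_down affH_subalg Hgl_subalg affH_Hgl _ _ Lx) => f Ff.
      by apply: affTaff_Hgl; apply: down_affH_rho.
    by apply: affTaff_exchange_down; apply: down_affH_rho.
  by rewrite (_ : k.+1%:Z - 1 = k)%R //; lia.
- rewrite (_ : Negz k - 1 = Negz k.+1)%R; last by lia.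
  exact: (ladder_up affH_subalg (k := k.+1)).
Qed.

(** With [dD_down], this reduces left multiplication by A to [affH], [rho] and [down]. *)
Lemma natX_rho i : (i < m.+2)%N -> exists2 a, affH a & exists2 a', affH a' & X i = a * rho * a'.
Proof.
move=> im; exists (desc i * descV m.+1).
  by apply: affHM; [exact: affH_desc | exact: affH_descV].
exists (asc i); first exact: affH_asc.
by rewrite natX_desc_asc // (_ : X 0 = descV m.+1 * rho) ?mulrA // rhoE mulrA descVK mul1r.
Qed.

Lemma dD_down i : exists2 a, affH a & exists2 a', affH a' & dD q tau i = a * down * a'.
Proof.
have affH_prod r (P : pred 'I_m.+1) : affH (\prod_(k <- r | P k) @dT K m.+2 q tau k).
  by apply: subalg_prod => k _; right; exists k.
(* The factor [ascV m.+1] cancels the [asc m.+1] contained in [down]. *)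
exists ((\prod_(k <- enum 'I_m.+1 | (i <= k)%N) @dT K m.+2 q tau k) * ascV m.+1).
  by apply: affHM; [apply: affH_prod | apply: affH_ascV].
exists (\prod_(k <- rev (enum 'I_m.+1) | (i <= k)%N) @dT K m.+2 q tau k); first exact: affH_prod.
rewrite down_Dn -(mulrA _ (ascV _)) (mulrA (ascV _)) ascVK mul1r.
by rewrite /dD last_ord_inord.
Qed.

(** Left multiplication by a generator sends each layer into a layer, and [1] lies in layer 0. *)
Lemma frakA_layers : frakA m.+2 q tau `<=` lin_span [set x | exists d, layer d x].
Proof.
have ss := @lin_span_subspace _ _ _ [set x | exists d, layer d x].
apply: subalg_mull_ind => //.
  by apply: lin_span_gen; exists 0; case: Hgl_subalg.
move=> z s Vz gs.
have affL : affH s -> forall d x, layer d x -> exists d, layer d (s * x).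
  by move=> Fs d x Lx; exists d; apply: layer_mull.
suff sL : forall d x, layer d x -> exists d, layer d (s * x).
  rewrite -[s * z]mulr1; move: z Vz.
  by apply: lin_span_mul => // x [d /sL sx]; apply: lin_span_gen; rewrite mulr1.
case: gs {z Vz} => [[[[[i _ <-]|[i _ <-]]|Ys]|Ys]|Ts].
- move=> d x Lx; have [a Fa [a' Fa' e]] := natX_rho (ltn_ord i).
  rewrite (_ : dX q tau i = X i); last by rewrite /natX inord_val.
  exists (d + 1); rewrite e -!mulrA.
  by apply: layer_mull => //; apply: layer_rho; apply: layer_mull.
- move=> d x Lx; have [a Fa [a' Fa' ->]] := dD_down i.
  exists (d - 1); rewrite -(mulrA (a * down)) -(mulrA a).
  by apply: layer_mull => //; apply: layer_down; apply: layer_mull.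
- by apply: affL; apply: subalg_gen; left; left.
- by apply: affL; apply: subalg_gen; left; right.
- by apply: affL; apply: subalg_gen; right.
Qed.

(** * The endomorphism scaling degree d by [q ^ d], and its eigenvalues on the layers *)

Definition scaled_gen (g : daha_gen m.+2) : H := q ^ daha_deg g *: gen _ g.

(** Each relation is homogeneous, so both sides acquire the same power of [q]. *)
Lemma scaled_gen_rel s t : @daha_rel K m.+2 q tau s t ->
  aeval scaled_gen s = aeval scaled_gen t.
Proof.
have sT k : scaled_gen (Tgen k) = pres_pi _ (Gen (Tgen k)) by rewrite /scaled_gen expr0z scale1r.
have sY i : scaled_gen (Ygen i) = pres_pi _ (Gen (Ygen i)) by rewrite /scaled_gen expr0z scale1r.
have sYV i : scaled_gen (YVgen i) = pres_pi _ (Gen (YVgen i)) by rewrite /scaled_gen expr0z scale1r.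
have sX i : scaled_gen (Xgen i) = q *: pres_pi _ (Gen (Xgen i)) by rewrite /scaled_gen expr1z.
have sXV i : scaled_gen (XVgen i) = q^-1 *: pres_pi _ (Gen (XVgen i)) by [].
have prodE (r : seq 'I_m.+2) :
    aeval scaled_gen (foldr (fun i s => (Gen (Ygen i) * s)%AT) 1%:T%AT r)
    = pres_pi (@daha_rel K m.+2 q tau)
      (foldr (fun i s => (Gen (Ygen i) * s)%AT) 1%:T%AT r).
  elim: r => [|i r IH] /=; first by rewrite scale1r.
  by rewrite IH pres_piM sY.
have Ar a (x y : H) : x * (a *: y) = a *: (x * y) by rewrite pres_scalerAr.
have Al a (x y : H) : (a *: x) * y = a *: (x * y) by rewrite pres_scalerAl.
move=> r; have := daha_relE r.
case: r => [k|k l _|k l _|k i j _ _|k i _ _|k i j _ _|k i _ _|i|k i j _ _ _|i|i|i j|i|i|i j] /=.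
all: rewrite ?prodE ?(sT, sX, sXV, sY, sYV) ?(pres_piM, pres_piD, pres_piC) // => e.
- by rewrite Ar Al; congr (_ *: _); exact: e.
- by rewrite Ar Al; congr (_ *: _); exact: e.
- move: (pres_pi _ (foldr _ _ _)) (pres_pi _ (Gen (Xgen i))) e => P x e.
  by rewrite Ar (Al q x P) Ar; congr (_ *: _); exact: e.
- rewrite Ar Ar Al Al scalerA mulVf // scale1r; exact: e.
- rewrite Al Ar scalerA mulfV // e scale1r //.
- rewrite Al Ar scalerA mulVf // e scale1r //.
- rewrite !Al !Ar; congr (_ *: (_ *: _)); exact: e.
Qed.

Definition twist : H -> H := pres_ext scaled_gen.

Lemma twistM x y : twist (x * y) = twist x * twist y.
Proof. exact: pres_extM scaled_gen_rel _ _. Qed.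
Lemma twist1 : twist 1 = 1. Proof. exact: pres_ext1 scaled_gen_rel. Qed.
Lemma twist_comb a x y : twist (a *: x + y) = a *: twist x + twist y.
Proof. exact: pres_ext_comb scaled_gen_rel _ _ _. Qed.
Lemma twist_gen g : twist (gen _ g) = q ^ daha_deg g *: gen _ g.
Proof. exact: pres_ext_gen scaled_gen_rel _. Qed.
Lemma twist0 : twist 0 = 0.
Proof. by have := twist_comb (-1) 0 0; rewrite scaler0 addr0 scaleN1r addNr. Qed.

Lemma twist_fix_subalg : is_subalg [set x | twist x = x].
Proof.
split; first exact: twist1.
  by split=> [|a x y /= ex ey]; [exact: twist0 | rewrite twist_comb ex ey].
by move=> x y /= ex ey; rewrite twistM ex ey.
Qed.

Lemma twist_affH x : affH x -> twist x = x.
Proof.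
move: x; apply: (subalg_ind twist_fix_subalg) => x.
by case=> [[[i _ <-]|[i _ <-]]|[i _ <-]]; rewrite /= twist_gen expr0z scale1r.
Qed.

Lemma twist_rho : twist rho = q *: rho.
Proof.
rewrite rhoE twistM twist_affH; last exact: affH_desc.
by rewrite twist_gen expr1z pres_scalerAr.
Qed.

Lemma twist_down : twist down = q^-1 *: down.
Proof.
have tXV : twist (XV m.+1) = q^-1 *: XV m.+1 by apply: twist_gen.
rewrite /down rhoVE twistM (twistM (asc _)) tXV (twist_affH (affH_asc _)).
by rewrite (twist_affH affH_fYn) -(pres_scalerAr _ (asc _)) -(pres_scalerAl q^-1).
Qed.

Lemma twist_dD i : twist (dD q tau i) = q^-1 *: dD q tau i.
Proof.
have [a Fa [a' Fa' ->]] := dD_down i.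
by rewrite twistM (twistM a) twist_down (twist_affH Fa) (twist_affH Fa') -(pres_scalerAr _ a) -(pres_scalerAl q^-1).
Qed.

Lemma twist_Hgl x : B x -> twist x = x.
Proof.
move: x; apply: (subalg_ind twist_fix_subalg) => x.
case=> [[[[i _ <-]|[i _ <-]]|[i _ <-]]|[[i j] _ <-]] /=; last first.
  rewrite /de twistM twist_dD twist_gen expr1z.
  by rewrite -pres_scalerAr -pres_scalerAl scalerA mulVf // scale1r.
all: by rewrite twist_gen expr0z scale1r.
Qed.

(** Each of the [k] factors [u] contributes [e], while [affH] and [B] are fixed. *)
Lemma twist_ladder u e k x : twist u = e *: u ->
  ladder affH B u k x -> twist x = e ^+ k *: x.
Proof.
move=> ue; elim: k x => [|k IH] x; first by rewrite scale1r; apply: twist_Hgl.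
move: x; apply: lin_span_ind => [|x [f Ff [y Ly ->]]].
  split=> [|a x y /= ex ey]; first by rewrite /= twist0 scaler0.
  by rewrite twist_comb ex ey scalerDr !scalerA mulrC.
rewrite /= !twistM ue (twist_affH Ff) (IH _ Ly).
by rewrite -!pres_scalerAr -!pres_scalerAl scalerA -exprSr.
Qed.

Lemma twist_layer d x : layer d x -> twist x = q ^ d *: x.
Proof.
case: d => k; first by apply: twist_ladder; apply: twist_rho.
by move/(twist_ladder twist_down); rewrite exprVn.
Qed.

Lemma twist_daha_part0 x : daha_part m.+2 q tau 0 x -> twist x = x.
Proof.
move: x; apply: lin_span_ind => [|x [r /= r0 <-]]; first by case: twist_fix_subalg.
(* The induction on words needs arbitrary degree, since the tail of a word of degree 0 may have any
   degree. *)
suff -> : twist (\prod_(g <- r) gen _ g)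
    = q ^ (\sum_(g <- r) daha_deg g) *: \prod_(g <- r) gen _ g.
  by rewrite r0 expr0z scale1r.
elim: {r0} r => [|g r IH]; first by rewrite !big_nil expr0z scale1r twist1.
rewrite !big_cons twistM IH twist_gen -pres_scalerAr -pres_scalerAl scalerA.
by rewrite mulrC -expfzDr.
Qed.

(** * Degrees and the inclusion of [B] in the degree zero part of A *)

Lemma degree_partM d d' x y : daha_part m.+2 q tau d x -> daha_part m.+2 q tau d' y ->
  daha_part m.+2 q tau (d + d') (x * y).
Proof.
move=> Px Py; rewrite -[x * y]mulr1; move: y Py; apply: lin_span_mul.
  exact: lin_span_subspace.
move=> y [s /= sd <-]; rewrite mulr1 -[x]mul1r; move: x Px; apply: lin_span_mul.
  exact: lin_span_subspace.
move=> x [r /= rd <-]; apply: lin_span_gen; exists (r ++ s).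
  by rewrite /= big_cat rd sd.
by rewrite big_cat mul1r.
Qed.

Lemma degree_part_gen g : daha_part m.+2 q tau (daha_deg g) (gen _ g).
Proof. by apply: lin_span_gen; exists [:: g]; rewrite /= big_seq1. Qed.

Lemma degree_part0_subalg : is_subalg (daha_part m.+2 q tau 0).
Proof.
split; first by apply: lin_span_gen; exists [::]; rewrite /= big_nil.
  exact: lin_span_subspace.
by move=> x y Px Py; have := degree_partM Px Py; rewrite addr0.
Qed.

Lemma Hgl_degree0 : B `<=` daha_part m.+2 q tau 0.
Proof.
have P0 := degree_part0_subalg; have [_ sP0 _] := P0.
have PT r (P : pred 'I_m.+1) :
    daha_part m.+2 q tau 0 (\prod_(k <- r | P k) @dT K m.+2 q tau k).
  have [P1 _ PM] := P0.
  apply: (big_ind (daha_part m.+2 q tau 0)) => [|x y|k _].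
  - exact: P1.
  - exact: PM.
  - exact: (@degree_part_gen (@Tgen m.+2 k)).
apply: (subalg_ind P0) => x.
case=> [[[[i _ <-]|[i _ <-]]|[i _ <-]]|[[i j] _ <-]] /=.
- exact: (@degree_part_gen (Tgen i)).
- exact: (@degree_part_gen (Ygen i)).
- exact: (@degree_part_gen (YVgen i)).
(* [X i] has degree 1, so [e_ij] has degree 0 once [D j] has degree -1, which comes from its only
   factor [XV]. *)
suff PD : daha_part m.+2 q tau (-1) (dD q tau j).
  exact: (degree_partM (@degree_part_gen (Xgen i)) PD).
have PY : daha_part m.+2 q tau 0 (dY q tau (last_ord j) - dYV q tau (last_ord j)).
  by apply: (subspaceB sP0); [exact: (@degree_part_gen (Ygen _)) | exact: (@degree_part_gen (YVgen _))].
have PXY := degree_partM (@degree_part_gen (XVgen (last_ord j))) PY.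
have PS := subspaceZ (q - q^-1)^-1 (@lin_span_subspace _ _ _ _) PXY.
exact: (degree_partM (degree_partM (PT _ _) PS) (PT _ _)).
Qed.

Lemma Hgl_frakA : B `<=` frakA m.+2 q tau.
Proof.
have FM x y : frakA m.+2 q tau x -> frakA m.+2 q tau y -> frakA m.+2 q tau (x * y).
  exact: subalgM.
apply: subalg_sub => x.
case=> [[[Tx|Yx]|Yx]|[[i j] _ <-]] /=.
- by apply: subalg_gen; right.
- by apply: subalg_gen; left; left; right.
- by apply: subalg_gen; left; right.
by apply: (FM (dX q tau i) (dD q tau j)); apply: subalg_gen; left; left; left;
  [left; exists i | right; exists j].
Qed.

(** An element of A of degree zero is a sum of layer elements and is fixed by [twist]. As
    [q ^ d != 1] for [d != 0], it lies in layer 0. *)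
Theorem Hgl_frakA_degree0 : (forall k, (0 < k)%N -> q ^+ k != 1) ->
  B = frakA m.+2 q tau `&` daha_part m.+2 q tau 0.
Proof.
move=> q1; rewrite eqEsubset; split=> [x Bx|x [/frakA_layers Ax /twist_daha_part0 tx]].
  by split; [apply: Hgl_frakA | apply: Hgl_degree0].
apply: (fixed_in_layer0 twist_comb twist_layer _ _ Ax tx) => [d d0|].
  case: d d0 => k // k0; first by apply: q1; rewrite lt0n.
  (* For a negative exponent the power is the inverse of a positive one. *)
  by rewrite /= invr_eq1 q1.
by case: Hgl_subalg.
Qed.

End DahaIdentities.

(** * Specialisation to the field C(tau) *)

Theorem mainTheorem4 (R : realType) (n : nat) (q : complex R)
    (hn : (2 <= n)%N) (hq0 : q != 0)
    (hq : forall m : nat, (0 < m)%N -> q ^+ m != 1) :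
  Hgl n (embC q) (tauC R)
  = frakA n (embC q) (tauC R) `&` daha_part n (embC q) (tauC R) 0.
Proof.
case: n hn => [|[|m]] // _; apply: Hgl_frakA_degree0.
- by rewrite /embC tofrac_eq0 polyC_eq0.
- by rewrite /tauC tofrac_eq0 polyX_eq0.
(* The embedding of C into C(tau) by constants is an injective ring morphism, so [q] stays a
   non-root of unity. *)
- move=> k k0; rewrite /embC -rmorphXn -(rmorph1 (@tofrac _)) tofrac_eq /=.
  by rewrite -polyC_exp -polyC1 (inj_eq (@polyC_inj _)) hq.
Qed.
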